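(* Let $X$ be an integral scheme and let $\mathscr{F}$ be the class of locally torsion-free quasi-coherent sheaves on $X$. Then every quasi-coherent sheaf on $X$ has an $\mathscr{F}$-cover in $\mathfrak{Qcoh}(X)$.
   Context: $\mathfrak{Qcoh}(X)$ is the category of quasi-coherent sheaves on $X$. A quasi-coherent sheaf $\mathcal{F}$ on $X$ is locally torsion-free if $\mathcal{F}(U)$ is a torsion-free $\mathcal{O}_X(U)$-module for each (non-empty) affine open subset $U\subseteq X$. Let $\mathscr{F}$ be a class of objects of a category $\mathcal{C}$. A morphism $\phi:F\to M$ in $\mathcal{C}$ is an $\mathscr{F}$-precover of $M$ if $F\in\mathscr{F}$ and $\mathrm{Hom}(F',F)\to \mathrm{Hom}(F',M)\to 0$ is exact for every $F'\in\mathscr{F}$ (i.e. every morphism $F'\to M$ with $F'\in\mathscr{F}$ factors through $\phi$). It is an $\mathscr{F}$-cover if moreover every morphism $f:F\to F$ with $\phi\circ f=\phi$ is an isomorphism. *)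

(* Defs.v *)
From HB Require Import structures.
From mathcomp Require Import all_boot all_order all_algebra.
From mathcomp Require Import all_classical topology.

Set Implicit Arguments.
Unset Strict Implicit.
Unset Printing Implicit Defensive.

Import GRing.Theory.
Local Open Scope classical_set_scope.
Local Open Scope ring_scope.

(* Rings of sections are [comPzRingType]s: the zero ring must be allowed,
   since it is the ring of sections over the empty set. *)

Record category := Category {
  obj :> Type;
  hom : obj -> obj -> Type;
  idc : forall a, hom a a;
  compc : forall a b c, hom b c -> hom a b -> hom a c;
  compcA : forall a b c d (h : hom c d) (g : hom b c) (f : hom a b),
    compc h (compc g f) = compc (compc h g) f;
  comp1c : forall a b (f : hom a b), compc (idc b) f = f;
  compc1 : forall a b (f : hom a b), compc f (idc a) = f }.

Section Covers.
Variable C : category.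

Definition is_iso (a b : C) (f : hom a b) : Prop :=
  exists g : hom b a, compc g f = idc a /\ compc f g = idc b.

Definition precover (cF : C -> Prop) (F M : C) (phi : hom F M) : Prop :=
  cF F /\
  forall (F' : C) (psi : hom F' M), cF F' ->
    exists h : hom F' F, compc phi h = psi.

Definition cover (cF : C -> Prop) (F M : C) (phi : hom F M) : Prop :=
  precover cF phi /\ forall f : hom F F, compc phi f = phi -> is_iso f.

Definition has_cover (cF : C -> Prop) (M : C) : Prop :=
  exists (F : C) (phi : hom F M), cover cF phi.

End Covers.

Record spec (A : comPzRingType) := Spec {
  prime_set : set A;
  prime0 : prime_set 0;
  primeD : forall a b, prime_set a -> prime_set b -> prime_set (a + b);
  primeM : forall a b, prime_set b -> prime_set (a * b);
  prime1 : ~ prime_set 1;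
  primeP : forall a b, prime_set (a * b) -> prime_set a \/ prime_set b }.

Section Zariski.
Variable A : comPzRingType.

HB.instance Definition _ := gen_eqMixin (spec A).
HB.instance Definition _ := gen_choiceMixin (spec A).

Definition basic_open (f : A) : set (spec A) := [set p | ~ prime_set p f].

Definition zariski_open (W : set (spec A)) : Prop :=
  exists E : set A, W = \bigcup_(f in E) basic_open f.

Lemma zariski_openT : zariski_open setT.
Proof.
exists [set 1]; apply/seteqP; split=> // p _.
by exists 1 => //=; exact: prime1.
Qed.

Lemma zariski_openI : setI_closed zariski_open.
Proof.
move=> _ _ [E ->] [E' ->].
exists [set h | exists f g, [/\ E f, E' g & h = f * g]].
apply/seteqP; split=> p.
  move=> [[f Ef pf] [g Eg pg]]; exists (f * g); first by exists f, g.
  by move=> /primeP [].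
move=> [_ [f [g [Ef Eg ->]]] pfg]; split; [exists f | exists g] => // ?; apply: pfg.
  by rewrite mulrC; exact: primeM.
exact: primeM.
Qed.

Lemma zariski_open_bigU (I : Type) (W : I -> set (spec A)) :
  (forall i, zariski_open (W i)) -> zariski_open (\bigcup_i W i).
Proof.
move=> oW; exists [set f | exists i, basic_open f `<=` W i].
apply/seteqP; split=> p.
  move=> [i _ Wp]; have [E WE] := oW i; move: (Wp); rewrite WE => -[f Ef pf].
  by exists f => //; exists i; rewrite WE => q qf; exists f.
by move=> [f [i fW] pf]; exists i => //; exact: fW.
Qed.

HB.instance Definition _ := isOpenTopological.Build (spec A)
  zariski_openT zariski_openI zariski_open_bigU.

End Zariski.

Section Localization.
Variables (A B : comPzRingType).

(* [r : A -> B] exhibits B as the ring of fractions A_f. *)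
Definition localizes_ring (f : A) (r : A -> B) : Prop :=
  [/\ exists b, r f * b = 1,
      forall b, exists n a, r f ^+ n * b = r a
    & forall a a', r a = r a' -> exists n, f ^+ n * a = f ^+ n * a'].

(* [g : M -> N] exhibits N, seen as an A-module through r, as the module of
   fractions M_f. *)
Definition localizes_module (f : A) (r : A -> B) (M : lmodType A)
    (N : lmodType B) (g : M -> N) : Prop :=
  [/\ bijective (fun y : N => r f *: y),
      forall y, exists n x, r f ^+ n *: y = g x
    & forall x x', g x = g x' -> exists n, f ^+ n *: x = f ^+ n *: x'].

End Localization.

(* For R a domain, the only case in which it is used. *)
Definition torsion_free (R : comPzRingType) (M : lmodType R) : Prop :=
  forall (a : R) (x : M), a *: x = 0 -> a = 0 \/ x = 0.

Record opens (T : topologicalType) := Opens {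
  opens_set :> set T;
  opens_open : open opens_set }.

Definition opensI (T : topologicalType) (U V : opens T) : opens T :=
  Opens (openI (opens_open U) (opens_open V)).

(* The coverings of U are the sets C of open sets with union U; only the values
   of a family of local sections s on the members of C are relevant. *)
Definition sheaf_axiom (T : topologicalType) (F : opens T -> Type)
    (res : forall U V : opens T, V `<=` U -> F U -> F V) : Prop :=
  forall (U : opens T) (C : set (opens T)),
    \bigcup_(V in C) V = U :> set T ->
    (forall s t : F U,
      (forall (V : opens T) (VU : V `<=` U), C V -> res U V VU s = res U V VU t) ->
      s = t) /\
    (forall s : forall V, F V,
      (forall V W, C V -> C W ->
        res V (opensI V W) (@subIsetl _ V W) (s V) =
        res W (opensI V W) (@subIsetr _ V W) (s W)) ->
      exists t : F U, forall (V : opens T) (VU : V `<=` U), C V -> res U V VU t = s V).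

Record ringedSpace := RingedSpace {
  points :> topologicalType;
  sect : opens points -> comPzRingType;
  res : forall U V : opens points, V `<=` U -> {rmorphism sect U -> sect V};
  res_id : forall (U : opens points) (UU : U `<=` U) a, res UU a = a;
  res_comp : forall (U V W : opens points)
    (VU : V `<=` U) (WV : W `<=` V) (WU : W `<=` U) a,
    res WV (res VU a) = res WU a;
  res_sheaf : @sheaf_axiom points sect (fun U V VU => res VU) }.

(* An isomorphism between the ringed spaces Spec A and (U, O_U).  The structure
   sheaf of Spec A is the unique sheaf whose sections on each D(f) are A_f, with
   the canonical restriction maps, so the isomorphism of sheaves is given by a
   ring morphism A -> O(U) which induces A_f = O(V) whenever V is the image of
   D(f). *)
Record affine_chart (X : ringedSpace) (U : opens X) := AffineChart {
  chart_ring : comPzRingType;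
  chart_map : spec chart_ring -> X;
  chart_inj : injective chart_map;
  chart_range : range chart_map = U;
  chart_continuous : continuous chart_map;
  chart_open_map : forall W, open W -> open (chart_map @` W);
  chart_sect : {rmorphism chart_ring -> sect U};
  chart_loc : forall (f : chart_ring) (V : opens X) (VU : V `<=` U),
    chart_map @` basic_open f = V :> set X ->
    localizes_ring f (res VU \o chart_sect) }.

Arguments chart_map {X U} _ _.

Definition affine_open (X : ringedSpace) (U : opens X) : Prop :=
  inhabited (affine_chart U).

(* Local rings need not be mentioned: the stalks of a ringed space which is
   locally isomorphic to spectra are local. *)
Record scheme := Scheme {
  scheme_space :> ringedSpace;
  scheme_affine : forall x : scheme_space,
    exists U : opens scheme_space, opens_set U x /\ affine_open U }.

Definition integral_scheme (X : scheme) : Prop :=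
  [set: X] !=set0 /\
  forall U : opens X, U !=set0 ->
    (1 : sect U) <> 0 /\ GRing.integral_domain_axiom (sect U).

Record moduleSheaf (X : ringedSpace) := ModuleSheaf {
  msect :> forall U : opens X, lmodType (sect U);
  mres : forall (U V : opens X) (VU : V `<=` U),
    {linear msect U -> msect V | res VU \; *:%R};
  mres_id : forall (U : opens X) (UU : U `<=` U) s, mres UU s = s;
  mres_comp : forall (U V W : opens X)
    (VU : V `<=` U) (WV : W `<=` V) (WU : W `<=` U) s,
    mres WV (mres VU s) = mres WU s;
  mres_sheaf : @sheaf_axiom X msect (fun U V VU => mres VU) }.

(* X is covered by open sets U = Spec A on which F is isomorphic to the sheaf
   associated with some A-module M, that is the unique sheaf of modules whose
   sections on each D(f) are M_f. *)
Definition quasi_coherent (X : scheme) (F : moduleSheaf X) : Prop :=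
  forall x : X, exists (U : opens X) (c : affine_chart U),
    opens_set U x /\
    exists (M : lmodType (chart_ring c))
           (g : {linear M -> F U | chart_sect c \; *:%R}),
      forall (f : chart_ring c) (V : opens X) (VU : V `<=` U),
        chart_map c @` basic_open f = V :> set X ->
        localizes_module f (res VU \o chart_sect c) (mres F VU \o g).

Record module_hom (X : ringedSpace) (F G : moduleSheaf X) := ModuleHom {
  mhom :> forall U : opens X, F U -> G U;
  mhom_linear : forall U, linear (@mhom U);
  mhom_natural : forall (U V : opens X) (VU : V `<=` U) s,
    mres G VU (mhom s) = mhom (mres F VU s) }.

Arguments mhom {X F G} _ U _.

Section ModuleCategory.
Variable X : ringedSpace.
Implicit Types F G H : moduleSheaf X.

Lemma module_hom_eq F G (f g : module_hom F G) :
  (forall U s, f U s = g U s) -> f = g.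
Proof.
case: f g => [f fl fn] [g gl gn] /= fg.
have e : f = g by apply: functional_extensionality_dep => U; apply/funext => s.
by subst g; congr ModuleHom; exact: Prop_irrelevance.
Qed.

Definition module_id F : module_hom F F.
Proof. by exists (fun U => id). Defined.

Definition module_comp F G H (g : module_hom G H) (f : module_hom F G) :
  module_hom F H.
Proof.
exists (fun U => g U \o f U).
- by move=> U a x y /=; rewrite !mhom_linear.
- by move=> U V VU s /=; rewrite !mhom_natural.
Defined.

End ModuleCategory.

Record qcohSheaf (X : scheme) := QcohSheaf {
  qcoh_sheaf :> moduleSheaf X;
  qcohP : quasi_coherent qcoh_sheaf }.

Definition Qcoh (X : scheme) : category.
Proof.
refine (@Category (qcohSheaf X) (fun F G => module_hom F G)
  (fun F => module_id F) (fun F G H g f => module_comp g f) _ _ _).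
- by move=> *; exact: module_hom_eq.
- by move=> *; exact: module_hom_eq.
- by move=> *; exact: module_hom_eq.
Defined.

Definition locally_torsion_free (X : scheme) (F : qcohSheaf X) : Prop :=
  forall U : opens X, U !=set0 -> affine_open U -> torsion_free (F U).

(* Main.v *)
From HB Require Import structures.
Require Import Defs.
From mathcomp Require Import all_boot all_order all_algebra generic_quotient.
From mathcomp Require Import all_classical topology.

Set Implicit Arguments.
Unset Strict Implicit.
Unset Printing Implicit Defensive.

Import Order.TTheory GRing.Theory Num.Theory.
Local Open Scope classical_set_scope.
Local Open Scope ring_scope.

(** A torsion-free quasi-coherent sheaf on the integral scheme X is a subsheaf of a
    constant sheaf, given by a vector space over the function field K.  So the
    proof takes place among the quasi-coherent subsheaves of constant sheaves,
    encoded by their stalks ([qcoh_family]); by [qcoh_family_local] this notion is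
    stable under sums, intersections, images, inverse images and directed unions.

    Torsion-free covers over a domain can be obtained from injective modules: if M
    is contained in an injective module E, the maps u from K to E with u(1) in M
    form a torsion-free precover of M, by evaluation at 1, and a cover if E is the
    injective hull of M.  Here E is a product of skyscraper sheaves, whose
    stalks are modules of additive maps to Q/Z.  It is not quasi-coherent, but the
    linear maps from K to E form a K-vector space V ([universal_space]).  Let F be
    the largest quasi-coherent subsheaf of V that evaluates into M
    ([cover_family]), and N the kernel of its map to M ([kernel_family]).  A
    torsion-free sheaf over M maps to F ([torsion_free_lift]): its generic stalk
    maps to V because additive maps to Q/Z extend to larger groups.  The same
    extension property makes V/N injective with respect to inclusions of
    quasi-coherent subsheaves of V ([relative_injectivity]).

    The injective hull of F/N can then be found inside V/N by taking complements
    twice, as in a module category.  Since N contains no subspace of V, it has the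
    form pV/N for an idempotent p of V ([essential_projection]), and the
    intersection of F with pV is the required cover.  It is still a
    precover, because p is the identity on F modulo N.  An endomorphism over M
    extends to a K-linear endomorphism h of pV, which is the identity on F modulo N.
    As F/N is essential in pV/N, such an h is injective modulo N; then it has a
    retraction, by injectivity, and the retraction is injective for the same reason
    ([identity_on_family_invertible]).  So h is invertible, and its inverse
    preserves the intersection of F and pV. *)

(** * Extending additive maps into Q/Z *)

(** Zorn's lemma above a given set; the chains that matter are nonempty, since
    the base set can be added to any of them. *)
Lemma Zorn_above (T : Type) (P : set (set T)) (A : set T) :
  P A ->
  (forall C : set (set T), C !=set0 -> C `<=` P -> total_on C subset ->
     P (\bigcup_(B in C) B)) ->
  exists M, [/\ P M, A `<=` M & forall B, P B -> M `<=` B -> B `<=` M].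
Proof.
move=> PA chainP.
have [|M [PM maxM]] := @Zorn_bigcup T [set B | P (B `|` A)].
  move=> C CP totC.
  have [->|/set0P C0] := eqVneq C set0; first by rewrite /= bigcup_set0 set0U.
  rewrite /= (_ : _ `|` A = \bigcup_(B in (setU A) @` C) B); last first.
    apply/seteqP; split=> [x [[B CB Bx]|Ax]|x [_ [B CB <-]] [Ax|Bx]].
    - by exists (A `|` B); [exists B|right].
    - by have [B CB] := C0; exists (A `|` B); [exists B|left].
    - by right.
    - by left; exists B.
  apply: chainP.
  - by have [B CB] := C0; exists (A `|` B), B.
  - by move=> _ [B CB <-]; rewrite setUC; exact: CP.
  - move=> _ _ [B CB <-] [B' CB' <-].
    by have [BB'|B'B] := totC _ _ CB CB'; [left|right]; exact: setUS.
exists (M `|` A); split=> // B PB MB z Bz; left.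
apply: contrapT => nMz; apply: (maxM B); last first.
  by rewrite /= (_ : B `|` A = B) //; apply/setUidPl => x Ax; apply: MB; right.
by split=> [x Mx|/(_ _ Bz)//]; apply: MB; left.
Qed.

Section AdditiveExtension.
Variable B : zmodType.

Definition subgroup (A : set B) : Prop :=
  A 0 /\ forall x y, A x -> A y -> A (x - y).

Variables (A : set B) (sA : subgroup A).

Lemma subgroup0 : A 0. Proof. by case: sA. Qed.

Lemma subgroupB x y : A x -> A y -> A (x - y).
Proof. by case: sA => _; apply. Qed.

Lemma subgroupN x : A x -> A (- x).
Proof. by move=> Ax; rewrite -sub0r; apply: subgroupB => //; exact: subgroup0. Qed.

Lemma subgroupD x y : A x -> A y -> A (x + y).
Proof. by move=> Ax Ay; rewrite -[y]opprK; apply: subgroupB => //; exact: subgroupN. Qed.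

Lemma subgroupMn x n : A x -> A (x *+ n).
Proof.
move=> Ax; elim: n => [|n IH]; first by rewrite mulr0n; exact: subgroup0.
by rewrite mulrS; exact: subgroupD.
Qed.

Lemma subgroupMz x (n : int) : A x -> A (x *~ n).
Proof.
by case: n => n Ax; rewrite ?NegzE ?mulrNz; try apply: subgroupN; exact: subgroupMn.
Qed.

End AdditiveExtension.

(** Divisibility, together with nonzero n-torsion for all n > 1 (the case where
    c is 0); a group of this kind receives enough additive maps to separate points. *)
Definition divisible_cogenerator (D : zmodType) : Prop :=
  forall (n : nat) (c : D), (1 < n)%N -> exists2 d : D, d <> 0 & d *+ n = c.

Section Extension.
Variables (B D : zmodType).
Hypothesis divD : divisible_cogenerator D.

Fact pairB (x y : B) (d e : D) : (x, d) - (y, e) = (x - y, d - e).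
Proof. by []. Qed.

Fact pairN (x : B) (d : D) : - (x, d) = (- x, - d).
Proof. by []. Qed.

Fact pairMz (x : B) (d : D) (n : int) : (x, d) *~ n = (x *~ n, d *~ n).
Proof.
have pairMn m : (x, d) *+ m = (x *+ m, d *+ m).
  by elim: m => [//|m IH]; rewrite !mulrS IH.
by case: n => n; rewrite ?NegzE ?mulrNz -?pmulrn pairMn.
Qed.

(** A partially defined additive map, as its graph. *)
Definition additive_graph (G : set (B * D)) : Prop :=
  subgroup G /\ forall d, G (0, d) -> d = 0.

Lemma additive_graph_fun (G : set (B * D)) b d d' :
  additive_graph G -> G (b, d) -> G (b, d') -> d = d'.
Proof.
move=> [sG fG] Gd Gd'; apply/eqP; rewrite -subr_eq0; apply/eqP/fG.
by have := subgroupB sG Gd Gd'; rewrite pairB subrr.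
Qed.

(** The multiples of b in the domain are the multiples of a single one, n b, and
    the value at b is a quotient by n of the value at n b; when n is 0 it is
    arbitrary, and when n is 1 it is forced. *)
Lemma additive_graph_step (G : set (B * D)) (b : B) : additive_graph G ->
  exists G' d, [/\ additive_graph G', G `<=` G', G' (b, d) &
    (forall e, ~ G (b, e)) -> d <> 0].
Proof.
move=> aG; have [sG fG] := aG.
have GMz x e (n : int) : G (x, e) -> G (x *~ n, e *~ n).
  by move=> Gx; rewrite -pairMz; exact: subgroupMz.
have [d [dG d0]] : exists d, (forall (n : int) e, G (b *~ n, e) -> e = d *~ n) /\
    ((forall e, ~ G (b, e)) -> d <> 0).
  have [ex|nex] := pselect (exists n : nat, `[< (0 < n)%N /\ exists e, G (b *+ n, e) >]).
    have [n /asboolP[n0 [e Ge]] nmin] := ex_minnP ex.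
    have val d : d *+ n = e -> forall (m : int) e', G (b *~ m, e') -> e' = d *~ m.
      move=> dn m e' Ge'.
      have Gr : G (b *~ (m %% n)%Z, e' - e *~ (m %/ n)%Z).
        have -> : (m %% n)%Z = m - n%:Z * (m %/ n)%Z.
          by apply/eqP; rewrite eq_sym subr_eq addrC mulrC -divz_eq.
        rewrite mulrzBr mulrzA.
        have := subgroupB sG Ge' (GMz _ _ (m %/ n)%Z Ge).
        by rewrite pairB -pmulrn.
      have r0 : (m %% n)%Z = 0.
        apply: contrapT => r0.
        have rn : (m %% n)%Z < n%:Z by rewrite ltz_mod // -lt0n.
        have := modz_ge0 m (_ : n%:Z != 0); rewrite -lt0n => /(_ n0).
        case: (m %% n)%Z r0 rn Gr => // r r0 rn Gr _.
        have /nmin : `[< (0 < r)%N /\ exists e, G (b *+ r, e) >].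
          apply/asboolP; split.
            by rewrite lt0n; apply/eqP => r00; apply: r0; rewrite r00.
          by exists (e' - e *~ (m %/ n)%Z); rewrite pmulrn.
        by rewrite leqNgt -ltz_nat rn.
      move: Gr; rewrite r0 mulr0z => /fG/eqP; rewrite subr_eq0 => /eqP ->.
      rewrite -dn pmulrn -mulrzA; congr (_ *~ _).
      by rewrite [in RHS](divz_eq m n) r0 addr0 mulrC.
    have [n1|n1] := eqVneq n 1%N.
      exists e; split; first by apply: val; rewrite n1.
      by move=> /(_ e); move: Ge; rewrite n1.
    have [|d d0 dn] := @divD n e; first by rewrite ltn_neqAle eq_sym n1.
    by exists d; split=> //; exact: val.
  have [d d0 _] := @divD 2%N 0 isT.
  exists d; split=> // n e Ge.
  have [n0|n0] := eqVneq n 0; first by move: Ge; rewrite n0 !mulr0z => /fG.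
  case: nex; exists `|n|%N; apply/asboolP; split; first by rewrite absz_gt0.
  have [n_ge|n_lt] := leP 0 n.
    by exists e; rewrite pmulrn gez0_abs.
  by exists (- e); rewrite pmulrn ltz0_abs // mulrNz; exact: (subgroupN sG Ge).
exists [set z | exists (n : int) w, G w /\ z = w + (b *~ n, d *~ n)], d; split=> //.
- split; first split.
  + exists 0, 0; split; first exact: subgroup0.
    by rewrite !mulr0z addr0.
  + move=> _ _ [n [w [Gw ->]]] [n' [w' [Gw' ->]]].
    exists (n - n'), (w - w'); split; first exact: subgroupB.
    by rewrite !mulrzBr opprD addrACA.
  + move=> e [n [[x y] [Gw [/eqP]]]].
    rewrite [0 == _]eq_sym addr_eq0 => /eqP xE ->.
    move: (subgroupN sG Gw); rewrite pairN xE opprK => /dG <-.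
    by rewrite subrr.
- by move=> w Gw; exists 0, w; rewrite !mulr0z addr0.
- by exists 1, 0; split; [exact: subgroup0|rewrite add0r !mulr1z].
Qed.

Lemma additive_extension (G : set (B * D)) : additive_graph G ->
  exists e : B -> D, zmod_morphism e /\ forall b d, G (b, d) -> e b = d.
Proof.
move=> aG.
have [|M [aM GM maxM]] := @Zorn_above _ additive_graph G aG.
  move=> C [S0 CS0] CP totC; split; last first.
    by move=> d [S CS]; case: (CP _ CS) => _; apply.
  split; first by exists S0 => //; case: (CP _ CS0) => -[].
  move=> x y [S CS Sx] [S' CS' S'y].
  have [SS'|S'S] := totC _ _ CS CS'.
    by exists S' => //; have [sS' _] := CP _ CS'; apply: subgroupB => //; exact: SS'.
  by exists S => //; have [sS _] := CP _ CS; apply: subgroupB => //; exact: S'S.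
have /choice[e eM] : forall b, exists d, M (b, d).
  move=> b; have [M' [d [aM' MM' M'd _]]] := additive_graph_step b aM.
  by exists d; exact: maxM M'd.
exists e; split=> [x y|b d Gb]; last exact: (additive_graph_fun aM (eM b) (GM _ Gb)).
apply: (additive_graph_fun aM (eM _)); rewrite -pairB.
by have [sM _] := aM; apply: subgroupB => //; exact: eM.
Qed.

(** By [additive_graph_step] the zero map on 0 extends to b with a nonzero value. *)
Lemma additive_separation (b : B) : b <> 0 ->
  exists e : B -> D, zmod_morphism e /\ e b <> 0.
Proof.
move=> b0; have a0 : additive_graph [set 0].
  split; first by split=> [//|x y -> ->]; rewrite subr0.
  by move=> d [].
have [G [d [aG _ Gbd d0]]] := additive_graph_step b a0.
have [e [eD eG]] := additive_extension aG.
by exists e; split=> //; rewrite (eG _ _ Gbd); apply: d0 => d' [].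
Qed.

End Extension.

Definition integral_rat : {pred rat} := [pred r | r \is a Num.int].

Fact integral_rat_closed : zmod_closed integral_rat.
Proof. by split=> [|x y]; [exact: rpred0|exact: rpredB]. Qed.

HB.instance Definition _ :=
  GRing.isZmodClosed.Build rat integral_rat integral_rat_closed.

Definition QmodZ : zmodType := Quotient.quot integral_rat.

Lemma QmodZ_divisible : divisible_cogenerator QmodZ.
Proof.
move=> n c n1; have n0 : n%:R != 0 :> rat by rewrite pnatr_eq0 -lt0n ltnW.
pose pi (r : rat) : QmodZ := (\pi_QmodZ r)%qT.
have piMn r : pi r *+ n = pi (r *+ n).
  elim: (n) => [|m IH]; first by rewrite !mulr0n /pi piE.
  by rewrite !mulrS IH /pi piE.
have pi0 r : (pi r = 0) <-> r \is a Num.int.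
  rewrite (_ : 0 = pi 0 :> QmodZ); last by rewrite /pi piE.
  have := Quotient.idealrBE integral_rat r 0; rewrite subr0 => rE.
  by split=> [/eqP|rZ]; [|apply/eqP]; rewrite /pi -rE.
pose r := repr c.
have cE : c = pi r by rewrite /pi reprK.
have [d0|d0] := pselect (pi (r / n%:R) = 0); last first.
  by exists (pi (r / n%:R)) => //; rewrite piMn -(mulr_natr (r / _)) divfK.
exists (pi ((r + 1) / n%:R)); last first.
  rewrite piMn -(mulr_natr (_ / _)) divfK // cE; apply/eqP.
  by rewrite /pi -Quotient.idealrBE addrAC subrr add0r.
rewrite mulrDl => /pi0; move/pi0 in d0; rewrite rpredDl // mul1r => /intrP[m mE].
have : n%:R * m%:~R = 1 :> rat by rewrite -mE mulfV.
rewrite pmulrn -intrM => /(@intr_inj _ _ 1)/(congr1 absz)/eqP.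
by rewrite abszM muln_eq1 /= => /andP[/eqP n1E]; rewrite n1E in n1.
Qed.

(** * Prime ideals and affine charts *)

Section PrimeIdeals.
Variable A : comPzRingType.

Definition ideal (J : set A) : Prop :=
  [/\ J 0, forall a b, J a -> J b -> J (a + b) & forall a b, J b -> J (a * b)].

(** An ideal that is maximal among those that contain no power of f is prime. *)
Lemma exists_prime (J : set A) (f : A) : ideal J -> (forall n, ~ J (f ^+ n)) ->
  exists p : spec A, J `<=` prime_set p /\ ~ prime_set p f.
Proof.
move=> iJ Jf; pose P (S : set A) := ideal S /\ forall n, ~ S (f ^+ n).
have [//||M [[[M0 MD MM] Mf] JM maxM]] := @Zorn_above _ P J.
  move=> C [S0 CS0] CP totC; split; last first.
    by move=> n [S CS]; case: (CP _ CS) => _; apply.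
  split.
  - by exists S0 => //; case: (CP _ CS0) => -[].
  - move=> x y [S CS Sx] [S' CS' S'y].
    have [SS'|S'S] := totC _ _ CS CS'.
      by exists S' => //; have [[_ SD _] _] := CP _ CS'; apply: SD => //; exact: SS'.
    by exists S => //; have [[_ SD _] _] := CP _ CS; apply: SD => //; exact: S'S.
  - move=> a b [S CS Sb]; exists S => //.
    by have [[_ _ SM] _] := CP _ CS; exact: SM.
have powM a : ~ M a -> exists n x r, M x /\ f ^+ n = x + r * a.
  move=> Ma; apply: contrapT => nex; apply: Ma.
  apply: (maxM [set y | exists x r, M x /\ y = x + r * a]).
  - split=> [|n [x [r [Mx fE]]]]; last by apply: nex; exists n, x, r.
    split.
    + by exists 0, 0; rewrite mul0r addr0.
    + move=> _ _ [x [r [Mx ->]]] [y [s [My ->]]]; exists (x + y), (r + s).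
      by split; [exact: MD|rewrite mulrDl addrACA].
    + move=> b _ [x [r [Mx ->]]]; exists (b * x), (b * r).
      by split; [exact: MM|rewrite mulrDr mulrA].
  - by move=> x Mx; exists x, 0; rewrite mul0r addr0.
  - by exists 0, 1; rewrite mul1r add0r.
have M1 : ~ M 1 by exact: (Mf 0).
have Mprime a b : M (a * b) -> M a \/ M b.
  move=> Mab; apply: contrapT => /not_orP[/powM[n [x [r [Mx fn]]]]].
  move=> /powM[m [y [s [My fm]]]]; apply: (Mf (n + m)%N).
  rewrite exprD fn fm mulrDl; apply: (MD); first by rewrite mulrC; exact: MM.
  rewrite mulrDr; apply: MD; first exact: MM.
  by rewrite mulrACA; exact: MM.
exists (Spec M0 MD MM M1 Mprime); split=> //=.
by rewrite -[f]expr1; exact: Mf.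
Qed.

Lemma power_in_ideal (J : set A) (f : A) : ideal J ->
  (forall p : spec A, ~ prime_set p f -> exists a, J a /\ ~ prime_set p a) ->
  exists n, J (f ^+ n).
Proof.
move=> iJ Jp; apply: contrapT => nJ.
have [n Jn|p [Jp' pf]] := exists_prime iJ (f := f); first by apply: nJ; exists n.
by have [a [/Jp' pa npa]] := Jp p pf; exact: npa.
Qed.

Lemma primeX (p : spec A) f n : prime_set p (f ^+ n) -> prime_set p f.
Proof.
elim: n => [/prime1//|n IH]; rewrite exprS => /Defs.primeP[//|]; exact: IH.
Qed.

Lemma nprimeX (p : spec A) f n : ~ prime_set p f -> ~ prime_set p (f ^+ n).
Proof. by move=> pf /primeX. Qed.

Lemma nprimeM (p : spec A) a b :
  ~ prime_set p a -> ~ prime_set p b -> ~ prime_set p (a * b).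
Proof. by move=> pa pb /Defs.primeP[]. Qed.

Lemma open_basic (f : A) : open (basic_open f).
Proof. by exists [set f]; rewrite bigcup_set1. Qed.

End PrimeIdeals.

Lemma opens_eq (T : topologicalType) (U V : opens T) : U = V :> set T -> U = V.
Proof.
case: U V => [U oU] [V oV] /= UV; move: oU oV; rewrite UV => oU oV.
by rewrite (Prop_irrelevance oU oV).
Qed.

Lemma opensIl (T : topologicalType) (U V : opens T) : opensI U V `<=` U.
Proof. exact: subIsetl. Qed.

Lemma opensIr (T : topologicalType) (U V : opens T) : opensI U V `<=` V.
Proof. exact: subIsetr. Qed.

Section Charts.
Variables (X : ringedSpace) (U : opens X) (c : affine_chart U).
Local Notation A := (chart_ring c).

Definition chart_basic (f : A) : opens X :=
  Opens (chart_open_map (a := c) (@open_basic A f)).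

Lemma chart_in (p : spec A) : opens_set U (chart_map c p).
Proof. by rewrite -(chart_range c); exists p. Qed.

Lemma chart_onto x : opens_set U x -> exists p : spec A, x = chart_map c p.
Proof. by rewrite -{1}(chart_range c) => -[p _ <-]; exists p. Qed.

Lemma chart_basic_sub f : chart_basic f `<=` U.
Proof. by move=> _ [p _ <-]; exact: chart_in. Qed.

Lemma chart_basicE f p : opens_set (chart_basic f) (chart_map c p) <-> ~ prime_set p f.
Proof. by split=> [[q qf /chart_inj <-]//|pf]; exists p. Qed.

Lemma chart_basis (Y : opens X) p : opens_set Y (chart_map c p) ->
  exists g, ~ prime_set p g /\ chart_basic g `<=` Y.
Proof.
move=> Yp.
have : open (chart_map c @^-1` Y).
  by apply: open_comp (opens_open Y) => q _; exact: chart_continuous.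
move=> [E EY]; have : (chart_map c @^-1` Y) p by [].
rewrite EY => -[g Eg pg]; exists g; split=> // _ [q qg <-].
suff : (chart_map c @^-1` Y) q by [].
by rewrite EY; exists g.
Qed.

Lemma chart_basic_loc f :
  localizes_ring f (res (@chart_basic_sub f) \o chart_sect c).
Proof. exact: chart_loc. Qed.

Lemma chart_unit f : exists b, res (@chart_basic_sub f) (chart_sect c f) * b = 1.
Proof. by have [] := chart_basic_loc f. Qed.

(** On a basic open set D(h) inside Y, the relation [f * u = 1] becomes
    [f * a = h ^ n] up to a power of h.  Invertibility near a point does not
    refer to the chart, so this lets one compare the functions of two charts. *)
Lemma chart_nonvanish (Y : opens X) (YU : Y `<=` U) p f (u : sect Y) :
  opens_set Y (chart_map c p) -> res YU (chart_sect c f) * u = 1 -> ~ prime_set p f.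
Proof.
move=> Yp fu pf; have [h [ph hY]] := chart_basis Yp.
have [_ frac inj] := chart_basic_loc h.
have [n [a /= ua]] := frac (res hY u).
have : res (@chart_basic_sub h) (chart_sect c (f * a)) =
       res (@chart_basic_sub h) (chart_sect c (h ^+ n)).
  rewrite !rmorphM /= -ua mulrCA.
  rewrite -(res_comp YU hY (@chart_basic_sub h) (chart_sect c f)).
  rewrite -(rmorphM (res hY)) fu rmorph1 mulr1.
  by rewrite !rmorphXn.
move=> /inj[m]; rewrite -exprD => hE; apply: ph; apply: (@primeX _ p h (m + n)%N).
by rewrite -hE mulrCA mulrC; exact: primeM.
Qed.

Lemma chart_sect_inj a : chart_sect c a = 0 -> a = 0.
Proof.
move=> a0; have [_ _ inj] := chart_basic_loc 1.
have /inj[n] : (res (@chart_basic_sub 1) \o chart_sect c) a =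
               (res (@chart_basic_sub 1) \o chart_sect c) 0.
  by rewrite /= a0 !rmorph0.
by rewrite expr1n !mul1r.
Qed.

End Charts.

(** * Stalks *)

Record presheaf (T : topologicalType) := Presheaf {
  psect :> opens T -> zmodType;
  pres : forall U V : opens T, V `<=` U -> psect U -> psect V;
  pres_additive : forall (U V : opens T) (VU : V `<=` U), zmod_morphism (pres VU);
  pres_comp : forall (U V W : opens T)
    (VU : V `<=` U) (WV : W `<=` V) (WU : W `<=` U) a,
    pres WV (pres VU a) = pres WU a }.

Section Stalk.
Variables (T : topologicalType) (G : presheaf T) (x : T).

Record germ_rep := GermRep {
  germ_dom : opens T;
  germ_dom_in : opens_set germ_dom x;
  germ_sect : G germ_dom }.

HB.instance Definition _ := gen_eqMixin germ_rep.
HB.instance Definition _ := gen_choiceMixin germ_rep.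

Definition same_germ (s t : germ_rep) : Prop :=
  exists (W : opens T) (Ws : W `<=` germ_dom s) (Wt : W `<=` germ_dom t),
    opens_set W x /\ pres Ws (germ_sect s) = pres Wt (germ_sect t).

Definition same_germb (s t : germ_rep) : bool := `[< same_germ s t >].

Fact same_germ_equiv : equiv_class_of same_germb.
Proof.
split=> [s|s t|t s u].
- apply/asboolP; exists (germ_dom s), (@subset_refl _ _), (@subset_refl _ _).
  by split=> //; exact: germ_dom_in.
- by apply: asbool_equiv_eq; split=> -[W [Ws [Wt [Wx e]]]]; exists W, Wt, Ws; split.
- move=> /asboolP[W [Ws [Wt [Wx e]]]] /asboolP[Y [Yt [Yu [Yx e']]]].
  have YW1 := @opensIl _ W Y; have YW2 := @opensIr _ W Y.
  apply/asboolP; exists (opensI W Y), (subset_trans YW1 Ws), (subset_trans YW2 Yu).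
  split=> //; rewrite -(pres_comp Ws YW1) e -(pres_comp Yu YW2) -e'.
  have YWt := subset_trans YW1 Wt.
  by rewrite (pres_comp Wt YW1 YWt) (pres_comp Yt YW2 YWt).
Qed.

Canonical same_germ_equivRel := EquivRelPack same_germ_equiv.

Definition stalk := {eq_quot same_germb}%qT.

HB.instance Definition _ := Choice.on stalk.

Definition germ (U : opens T) (Ux : opens_set U x) (s : G U) : stalk :=
  (\pi_stalk (GermRep Ux s))%qT.

Lemma germ_eqP (U V : opens T) (Ux : opens_set U x) (Vx : opens_set V x)
    (s : G U) (t : G V) :
  germ Ux s = germ Vx t <->
  exists (W : opens T) (WU : W `<=` U) (WV : W `<=` V),
    opens_set W x /\ pres WU s = pres WV t.
Proof.
split=> [/eqmodP/asboolP[W [WU [WV e]]]|[W [WU [WV e]]]]; first by exists W, WU, WV.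
by apply/eqmodP/asboolP; exists W, WU, WV.
Qed.

Lemma germP (a : stalk) :
  exists (U : opens T) (Ux : opens_set U x) (s : G U), a = germ Ux s.
Proof.
elim/quotW: a => -[U Ux s]; by exists U, Ux, s.
Qed.

Lemma germ_res (U V : opens T) (Ux : opens_set U x) (Vx : opens_set V x)
    (VU : V `<=` U) (s : G U) :
  germ Vx (pres VU s) = germ Ux s.
Proof.
by apply/germ_eqP; exists V, (@subset_refl _ _), VU; rewrite (pres_comp VU _ VU).
Qed.

Lemma germ_common2 (a b : stalk) :
  exists (U : opens T) (Ux : opens_set U x) (s t : G U), a = germ Ux s /\ b = germ Ux t.
Proof.
have [U [Ux [s ->]]] := germP a; have [V [Vx [t ->]]] := germP b.
have Wx : opens_set (opensI U V) x by [].
exists (opensI U V), Wx, (pres (@opensIl _ U V) s), (pres (@opensIr _ U V) t).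
by rewrite !germ_res.
Qed.

End Stalk.

(** Sums, products and scalar products on stalks all come from an operation on
    the sections over each open set. *)
Section StalkOperation.
Variables (T : topologicalType) (G H L : presheaf T) (x : T).
Variable op : forall U : opens T, G U -> H U -> L U.
Hypothesis op_res : forall (U V : opens T) (VU : V `<=` U) s t,
  pres VU (op s t) = op (pres VU s) (pres VU t).

Definition stalk_op (a : stalk G x) (b : stalk H x) : stalk L x :=
  let s := repr a in let t := repr b in
  germ (conj (germ_dom_in s) (germ_dom_in t) : opens_set (opensI _ _) x)
    (op (pres (@opensIl _ _ _) (germ_sect s)) (pres (@opensIr _ _ _) (germ_sect t))).

Lemma stalk_opE (U : opens T) (Ux : opens_set U x) (s : G U) (t : H U) :
  stalk_op (germ Ux s) (germ Ux t) = germ Ux (op s t).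
Proof.
rewrite /stalk_op.
have := reprK (germ Ux s); have := reprK (germ Ux t).
case: (repr (germ Ux s)) => V Vx s' /=; case: (repr (germ Ux t)) => W Wx t' /=.
move=> /germ_eqP[Y [YW [YU [Yx tE]]]] /germ_eqP[Z [ZV [ZU [Zx sE]]]].
apply/germ_eqP; have YZ1 := @opensIl _ Y Z; have YZ2 := @opensIr _ Y Z.
have YZVW : opensI Y Z `<=` opensI V W by move=> y [/YW ? /ZV].
exists (opensI Y Z), YZVW, (subset_trans YZ1 YU); split=> //.
rewrite !op_res (pres_comp _ _ (subset_trans YZ2 ZV)).
rewrite -(pres_comp ZV YZ2) sE (pres_comp _ _ (subset_trans YZ1 YU)).
rewrite (pres_comp _ _ (subset_trans YZ1 YW)).
by rewrite -(pres_comp YW YZ1) tE (pres_comp _ _ (subset_trans YZ1 YU)).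
Qed.

End StalkOperation.

Section StalkZmodule.
Variables (T : topologicalType) (G : presheaf T) (x : T).
Local Notation S := (stalk G x).

HB.instance Definition _ (U V : opens T) (VU : V `<=` U) :=
  GRing.isZmodMorphism.Build (G U) (G V) (pres VU) (@pres_additive _ G U V VU).

Definition stalk0 : S := germ (I : opens_set (Opens openT) x) 0.
Definition stalkD : S -> S -> S := stalk_op (fun U (s t : G U) => s + t).
Definition stalkN (a : S) : S := stalk_op (fun U (s t : G U) => - s) a a.

Fact stalkDE (U : opens T) (Ux : opens_set U x) (s t : G U) :
  stalkD (germ Ux s) (germ Ux t) = germ Ux (s + t).
Proof. by apply: stalk_opE => *; exact: raddfD. Qed.

Fact stalkNE (U : opens T) (Ux : opens_set U x) (s : G U) :
  stalkN (germ Ux s) = germ Ux (- s).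
Proof. by apply: stalk_opE => *; exact: raddfN. Qed.

Fact stalk0E (U : opens T) (Ux : opens_set U x) : stalk0 = germ Ux 0.
Proof.
apply/germ_eqP; exists U, (fun _ _ => I), (@subset_refl _ _); split=> //.
by rewrite !raddf0.
Qed.

Fact stalkDA : associative stalkD.
Proof.
move=> a b d; have [U [Ux [s [t [-> ->]]]]] := germ_common2 a b.
have [V [Vx [u ->]]] := germP d.
have Wx : opens_set (opensI U V) x by [].
rewrite -(germ_res Ux Wx (@opensIl _ U V)) -(germ_res Ux Wx (@opensIl _ U V) t).
by rewrite -(germ_res Vx Wx (@opensIr _ U V)) !stalkDE addrA.
Qed.

Fact stalkDC : commutative stalkD.
Proof.
move=> a b; have [U [Ux [s [t [-> ->]]]]] := germ_common2 a b.
by rewrite !stalkDE addrC.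
Qed.

Fact stalkD0 : left_id stalk0 stalkD.
Proof.
move=> a; have [U [Ux [s ->]]] := germP a.
by rewrite (stalk0E Ux) stalkDE add0r.
Qed.

Fact stalkDN : left_inverse stalk0 stalkN stalkD.
Proof.
move=> a; have [U [Ux [s ->]]] := germP a.
by rewrite (stalk0E Ux) stalkNE stalkDE addNr.
Qed.

HB.instance Definition _ := GRing.isZmodule.Build S stalkDA stalkDC stalkD0 stalkDN.

Fact germ_zmod_morphism (U : opens T) (Ux : opens_set U x) :
  zmod_morphism (@germ T G x U Ux).
Proof. by move=> s t; rewrite -stalkDE -stalkNE. Qed.

HB.instance Definition _ (U : opens T) (Ux : opens_set U x) :=
  GRing.isZmodMorphism.Build (G U) S (@germ T G x U Ux) (germ_zmod_morphism Ux).

End StalkZmodule.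

Section StructureStalk.
Variable X : ringedSpace.

Definition structure_presheaf : presheaf X :=
  @Presheaf X (@sect X) (fun U V VU => res VU)
    (fun U V VU => raddfB (res VU)) (@res_comp X).

Variable x : X.
Definition stalk_ring : Type := stalk structure_presheaf x.
HB.instance Definition _ := GRing.Zmodule.on stalk_ring.

Definition rgerm (U : opens X) (Ux : opens_set U x) (a : sect U) : stalk_ring :=
  germ (G := structure_presheaf) Ux a.

Definition stalk1 : stalk_ring := rgerm (I : opens_set (Opens openT) x) 1.
Definition stalkM : stalk_ring -> stalk_ring -> stalk_ring :=
  @stalk_op _ structure_presheaf structure_presheaf structure_presheaf x
    (fun U (s t : sect U) => s * t).

Fact stalkME (U : opens X) (Ux : opens_set U x) (s t : sect U) :
  stalkM (rgerm Ux s) (rgerm Ux t) = rgerm Ux (s * t).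
Proof. by apply: stalk_opE => *; exact: rmorphM. Qed.

Fact stalk1E (U : opens X) (Ux : opens_set U x) : stalk1 = rgerm Ux 1.
Proof.
apply/germ_eqP; exists U, (fun _ _ => I), (@subset_refl _ _); split=> //.
by rewrite /= !rmorph1.
Qed.

Fact rgermD (U : opens X) (Ux : opens_set U x) (s t : sect U) :
  rgerm Ux (s + t) = rgerm Ux s + rgerm Ux t.
Proof. exact: (raddfD (@germ _ structure_presheaf x U Ux)). Qed.

Lemma rgermP (a : stalk_ring) :
  exists (U : opens X) (Ux : opens_set U x) (s : sect U), a = rgerm Ux s.
Proof. exact: (@germP _ structure_presheaf x a). Qed.

Lemma rgerm_res (U V : opens X) (Ux : opens_set U x) (Vx : opens_set V x)
    (VU : V `<=` U) (s : sect U) :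
  rgerm Vx (res VU s) = rgerm Ux s.
Proof. exact: (@germ_res _ structure_presheaf). Qed.

Lemma rgerm_common3 (a b d : stalk_ring) :
  exists (U : opens X) (Ux : opens_set U x) (s t u : sect U),
    [/\ a = rgerm Ux s, b = rgerm Ux t & d = rgerm Ux u].
Proof.
have [U [Ux [s [t [-> ->]]]]] := @germ_common2 _ structure_presheaf x a b.
have [V [Vx [u ->]]] := rgermP d.
have Wx : opens_set (opensI U V) x by [].
exists (opensI U V), Wx, (res (@opensIl _ U V) s), (res (@opensIl _ U V) t).
by exists (res (@opensIr _ U V) u); rewrite !rgerm_res.
Qed.

Fact stalkMA : associative stalkM.
Proof.
move=> a b d; have [U [Ux [s [t [u [-> -> ->]]]]]] := rgerm_common3 a b d.
by rewrite !stalkME mulrA.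
Qed.

Fact stalkMC : commutative stalkM.
Proof.
move=> a b; have [U [Ux [s [t [_ [-> -> _]]]]]] := rgerm_common3 a b a.
by rewrite !stalkME mulrC.
Qed.

Fact stalk1M : left_id stalk1 stalkM.
Proof.
move=> a; have [U [Ux [s ->]]] := rgermP a.
by rewrite (stalk1E Ux) stalkME mul1r.
Qed.

Fact stalkMDl : left_distributive stalkM +%R.
Proof.
move=> a b d; have [U [Ux [s [t [u [-> -> ->]]]]]] := rgerm_common3 a b d.
by rewrite -rgermD !stalkME mulrDl rgermD.
Qed.

HB.instance Definition _ :=
  GRing.Zmodule_isComPzRing.Build stalk_ring stalkMA stalkMC stalk1M stalkMDl.

Fact rgerm_zmod_morphism (U : opens X) (Ux : opens_set U x) : zmod_morphism (@rgerm U Ux).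
Proof. exact: (raddfB (@germ _ structure_presheaf x U Ux)). Qed.

Fact rgerm_monoid_morphism (U : opens X) (Ux : opens_set U x) :
  monoid_morphism (@rgerm U Ux).
Proof. by split=> [|s t]; [rewrite -stalk1E|rewrite -stalkME]. Qed.

HB.instance Definition _ (U : opens X) (Ux : opens_set U x) :=
  GRing.isZmodMorphism.Build (sect U) stalk_ring (@rgerm U Ux)
    (rgerm_zmod_morphism Ux).
HB.instance Definition _ (U : opens X) (Ux : opens_set U x) :=
  GRing.isMonoidMorphism.Build (sect U) stalk_ring (@rgerm U Ux)
    (rgerm_monoid_morphism Ux).

End StructureStalk.

Section ModuleStalk.
Variables (X : ringedSpace) (F : moduleSheaf X).

Definition module_presheaf : presheaf X :=
  @Presheaf X (@msect X F) (fun U V VU => mres F VU)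
    (fun U V VU => raddfB (mres F VU)) (@mres_comp X F).

Variable x : X.
Definition stalk_mod : Type := stalk module_presheaf x.
HB.instance Definition _ := GRing.Zmodule.on stalk_mod.

Definition mgerm (U : opens X) (Ux : opens_set U x) (s : F U) : stalk_mod :=
  germ (G := module_presheaf) Ux s.

HB.instance Definition _ (U : opens X) (Ux : opens_set U x) :=
  GRing.isZmodMorphism.Build (F U) stalk_mod (@mgerm U Ux)
    (raddfB (@germ _ module_presheaf x U Ux)).

Lemma mgermP (a : stalk_mod) :
  exists (U : opens X) (Ux : opens_set U x) (s : F U), a = mgerm Ux s.
Proof. exact: (@germP _ module_presheaf x a). Qed.

Lemma mgerm_res (U V : opens X) (Ux : opens_set U x) (Vx : opens_set V x)
    (VU : V `<=` U) (s : F U) :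
  mgerm Vx (mres F VU s) = mgerm Ux s.
Proof. exact: (@germ_res _ module_presheaf). Qed.

Lemma mgerm_eq0 (U : opens X) (Ux : opens_set U x) (s : F U) : mgerm Ux s = 0 ->
  exists (W : opens X) (WU : W `<=` U), opens_set W x /\ mres F WU s = 0.
Proof.
rewrite -(raddf0 (mgerm Ux)) => /germ_eqP[W [WU [WV [Wx]]]].
by rewrite /= (raddf0 (mres F WV)) => e; exists W, WU.
Qed.

Definition stalkZ : stalk_ring x -> stalk_mod -> stalk_mod :=
  @stalk_op _ (structure_presheaf X) module_presheaf module_presheaf x
    (fun U (a : sect U) (s : F U) => a *: s).

Fact stalkZE (U : opens X) (Ux : opens_set U x) (a : sect U) (s : F U) :
  stalkZ (rgerm Ux a) (mgerm Ux s) = mgerm Ux (a *: s).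
Proof. by apply: stalk_opE => U' V' VU a' s'; exact: linearZ. Qed.

Lemma stalk_common (a b : stalk_ring x) (s t : stalk_mod) :
  exists (U : opens X) (Ux : opens_set U x) (a' b' : sect U) (s' t' : F U),
    [/\ a = rgerm Ux a', b = rgerm Ux b', s = mgerm Ux s' & t = mgerm Ux t'].
Proof.
have [U [Ux [a' [b' [-> ->]]]]] := @germ_common2 _ (structure_presheaf X) x a b.
have [V [Vx [s' [t' [-> ->]]]]] := @germ_common2 _ module_presheaf x s t.
have Wx : opens_set (opensI U V) x by [].
exists (opensI U V), Wx, (res (@opensIl _ U V) a'), (res (@opensIl _ U V) b').
exists (mres F (@opensIr _ U V) s'), (mres F (@opensIr _ U V) t').
by rewrite !rgerm_res !mgerm_res.
Qed.

Fact stalkZA a b s : stalkZ a (stalkZ b s) = stalkZ (a * b) s.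
Proof.
have [U [Ux [a' [b' [s' [_ [-> -> -> _]]]]]]] := stalk_common a b s s.
by rewrite -rmorphM !stalkZE scalerA.
Qed.

Fact stalk1Z : left_id 1 stalkZ.
Proof.
move=> s; have [U [Ux [s' ->]]] := mgermP s.
by rewrite -(rmorph1 (rgerm Ux)) stalkZE scale1r.
Qed.

Fact stalkZDr : right_distributive stalkZ +%R.
Proof.
move=> a s t; have [U [Ux [a' [_ [s' [t' [-> _ -> ->]]]]]]] := stalk_common a a s t.
by rewrite -raddfD !stalkZE scalerDr raddfD.
Qed.

Fact stalkZDl s : {morph stalkZ^~ s : a b / a + b}.
Proof.
move=> a b; have [U [Ux [a' [b' [s' [_ [-> -> -> _]]]]]]] := stalk_common a b s s.
by rewrite -raddfD !stalkZE scalerDl raddfD.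
Qed.

HB.instance Definition _ := GRing.Zmodule_isLmodule.Build (stalk_ring x) stalk_mod
  stalkZA stalk1Z stalkZDr stalkZDl.

Lemma mgermZ (U : opens X) (Ux : opens_set U x) (a : sect U) (s : F U) :
  mgerm Ux (a *: s) = rgerm Ux a *: mgerm Ux s.
Proof. by rewrite -stalkZE. Qed.

End ModuleStalk.

(** * The generic point of an integral scheme *)

Lemma sheaf_empty (T : topologicalType) (F : opens T -> Type)
    (r : forall U V : opens T, V `<=` U -> F U -> F V) (U : opens T) :
  sheaf_axiom r -> U `<=` set0 -> forall s t : F U, s = t.
Proof.
move=> sF U0 s t; have [|sep _] := sF U set0; last by apply: sep.
by rewrite bigcup_set0; apply/seteqP; split.
Qed.

Lemma sheaf_separated (T : topologicalType) (F : opens T -> Type)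
    (r : forall U V : opens T, V `<=` U -> F U -> F V) (U : opens T) (s t : F U) :
  sheaf_axiom r ->
  (forall x, opens_set U x -> exists (V : opens T) (VU : V `<=` U),
     opens_set V x /\ r _ _ VU s = r _ _ VU t) ->
  s = t.
Proof.
move=> sF st; pose C := [set V : opens T | exists VU : V `<=` U, r _ _ VU s = r _ _ VU t].
have [|sep _] := sF U C.
  apply/seteqP; split=> [x [V [VU _] /VU//]|x Ux].
  by have [V [VU [Vx e]]] := st x Ux; exists V => //; exists VU.
by apply: sep => V VU [VU' e]; rewrite (Prop_irrelevance VU VU').
Qed.

Section GenericPoint.
Variables (X : scheme) (intX : integral_scheme X).

(** If U and V were disjoint, the section 1 on U and 0 on V would be a nontrivial
    idempotent over their union. *)
Lemma irreducible (U V : opens X) : U !=set0 -> V !=set0 ->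
  exists x, opens_set U x /\ opens_set V x.
Proof.
move=> U0 V0; apply: contrapT => UV0.
have UV x : opens_set U x -> ~ opens_set V x by move=> Ux Vx; apply: UV0; exists x.
pose W : opens X := Opens (openU (opens_open U) (opens_open V)).
have UW : U `<=` W by left.
have VW : V `<=` W by right.
have VnU : ~ V `<=` U by move=> VU; have [x Vx] := V0; exact: UV (VU x Vx) Vx.
have [|sep glue] := @res_sheaf X W [set U; V].
  by rewrite bigcup_setU !bigcup_set1.
pose s (Y : opens X) : sect Y := if pselect (Y `<=` U) then 1 else 0.
have [|e eE] := glue s.
  move=> Y Z CY CZ; rewrite /s.
  case: pselect => YU; case: pselect => ZU; rewrite ?rmorph1 ?rmorph0 //;
    apply: (sheaf_empty (@res_sheaf X)) => x [Yx Zx].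
  - by case: CZ => ZE; rewrite ZE in Zx ZU; [apply: ZU|apply: (UV x); [exact: YU|]].
  - by case: CY => YE; rewrite YE in Yx YU; [apply: YU|apply: (UV x); [exact: ZU|]].
have eU : res UW e = 1.
  by rewrite (eE U UW) /s; [case: pselect => // -[]|left].
have eV : res VW e = 0 by rewrite (eE V VW) /s; [case: pselect|right].
have [_ dom] := intX.
have [W1 domW] : (1 : sect W) <> 0 /\ GRing.integral_domain_axiom (sect W).
  by apply: dom; have [x Ux] := U0; exists x; left.
have [U1 _] := dom U U0; have [V1 _] := dom V V0.
have /domW/orP[/eqP e0|/eqP e1] : e * (1 - e) = 0.
- apply: sep => Y YW [] /= YE; subst Y; rewrite rmorphM rmorphB rmorph1 rmorph0.
  + by rewrite (Prop_irrelevance YW UW) eU subrr mulr0.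
  + by rewrite (Prop_irrelevance YW VW) eV mul0r.
- by apply: U1; rewrite -eU e0 rmorph0.
- by apply: V1; rewrite -[1]subr0 -eV -(rmorph1 (res VW)) -rmorphB e1 rmorph0.
Qed.

Lemma chart_domain (U : opens X) (c : affine_chart U) (a b : chart_ring c) :
  U !=set0 -> a * b = 0 -> a = 0 \/ b = 0.
Proof.
move=> U0 ab; have [_ dom] := intX; have [_ domU] := dom U U0.
have /domU/orP[/eqP/chart_sect_inj|/eqP/chart_sect_inj] :
  chart_sect c a * chart_sect c b = 0 by rewrite -rmorphM ab rmorph0.
- by left.
- by right.
Qed.

Lemma chart_one (U : opens X) (c : affine_chart U) :
  U !=set0 -> (1 : chart_ring c) <> 0.
Proof.
move=> U0 /(congr1 (chart_sect c)); rewrite rmorph1 rmorph0.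
by have [_ dom] := intX; have [U1 _] := dom U U0; exact: U1.
Qed.

Lemma chart_domainX (U : opens X) (c : affine_chart U) (a : chart_ring c) n :
  U !=set0 -> a <> 0 -> a ^+ n <> 0.
Proof.
move=> U0 a0; elim: n => [|n IH].
  by rewrite expr0; exact: chart_one.
by rewrite exprS => /(chart_domain U0)[].
Qed.

Lemma nprime_neq0 (A : comPzRingType) (p : spec A) a : ~ prime_set p a -> a <> 0.
Proof. by move=> pa a0; apply: pa; rewrite a0; exact: prime0. Qed.

(** The point is the zero ideal of a chart; a basic open set that contains some
    point contains it. *)
Lemma generic_exists : exists eta : X, forall U : opens X, U !=set0 -> opens_set U eta.
Proof.
have [[x0 _] dom] := intX; have [U [Ux0 [c]]] := scheme_affine x0.
have U0 : U !=set0 by exists x0.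
pose A := chart_ring c.
have zD (a b : A) : [set 0] a -> [set 0] b -> [set 0] (a + b).
  by move=> -> ->; rewrite /= addr0.
have zM (a b : A) : [set 0] b -> [set 0] (a * b) by move=> ->; rewrite /= mulr0.
have z1 : ~ [set 0] (1 : A) by exact: chart_one.
have zP (a b : A) : [set 0] (a * b) -> [set 0] a \/ [set 0] b.
  exact: chart_domain.
pose p0 : spec A := @Spec A [set 0] erefl zD zM z1 zP.
exists (chart_map c p0) => Y /(irreducible U0)[x [/(chart_onto c)[p ->]]].
move=> /chart_basis[g [pg gY]]; apply: gY; apply/chart_basicE.
exact: nprime_neq0 pg.
Qed.

Definition generic : X := projT1 (cid generic_exists).

Lemma generic_in (U : opens X) x : opens_set U x -> opens_set U generic.
Proof. by move=> Ux; rewrite /generic; case: cid => eta /= etaP; apply: etaP; exists x. Qed.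

Definition function_field : comPzRingType := stalk_ring generic.

(** Totalized by 0 on the empty set, so that formulas about sections need no proof
    that U is nonempty. *)
Definition gval (U : opens X) (a : sect U) : function_field :=
  if pselect (opens_set U generic) is left Ueta then rgerm Ueta a else 0.

Lemma gvalE (U : opens X) (Ueta : opens_set U generic) (a : sect U) :
  gval a = rgerm Ueta a.
Proof.
by rewrite /gval; case: pselect => // Ueta'; rewrite (Prop_irrelevance Ueta Ueta').
Qed.

Fact gval_zmod_morphism (U : opens X) : zmod_morphism (@gval U).
Proof. by move=> a b; rewrite /gval; case: pselect => h; rewrite ?subr0 // raddfB. Qed.

HB.instance Definition _ (U : opens X) :=
  GRing.isZmodMorphism.Build (sect U) function_field (@gval U) (@gval_zmod_morphism U).

Lemma gvalM (U : opens X) (a b : sect U) : gval (a * b) = gval a * gval b.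
Proof. by rewrite /gval; case: pselect => h; [exact: rmorphM|rewrite mulr0]. Qed.

Lemma gval1 (U : opens X) x : opens_set U x -> gval (1 : sect U) = 1.
Proof. by move=> Ux; rewrite (gvalE (generic_in Ux)) rmorph1. Qed.

Lemma gvalX (U : opens X) (a : sect U) n x :
  opens_set U x -> gval (a ^+ n) = gval a ^+ n.
Proof.
move=> Ux; elim: n => [|n IH]; first by rewrite !expr0; exact: gval1 Ux.
by rewrite !exprS gvalM IH.
Qed.

Lemma gval_res (U V : opens X) (VU : V `<=` U) x (a : sect U) :
  opens_set V x -> gval (res VU a) = gval a.
Proof.
move=> Vx; have Veta := generic_in Vx.
by rewrite (gvalE Veta) (gvalE (VU _ Veta)); exact: rgerm_res.
Qed.

Lemma gval_chart_unit (U : opens X) (c : affine_chart U) (p : spec (chart_ring c)) a :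
  ~ prime_set p a ->
  exists (Y : opens X) (b : sect Y),
    opens_set Y (chart_map c p) /\ gval b * gval (chart_sect c a) = 1.
Proof.
move=> pa; have [b ab] := chart_unit a; exists (chart_basic a), b.
have ap : opens_set (chart_basic a) (chart_map c p) by apply/chart_basicE.
split=> //; rewrite -(gval_res (@chart_basic_sub _ _ c a) _ ap) -gvalM mulrC ab.
exact: gval1 ap.
Qed.

(** * Quasi-coherent families of stalks *)

Section Families.
Variable V : lmodType function_field.
Implicit Types S T : X -> set V.

(** A subsheaf of the constant sheaf V is encoded by its stalks, a submodule of
    V over each local ring of X. *)
Definition stalk_family S : Prop := forall x,
  [/\ S x 0, forall u v, S x u -> S x v -> S x (u + v) &
      forall (U : opens X) (a : sect U) v,
        opens_set U x -> S x v -> S x (gval a *: v)].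

(** On a chart Spec A, the stalks are the localizations of the A-module of
    sections over the whole chart: a germ at p becomes a section after
    multiplication by an element outside p. *)
Definition qcoh_at (U : opens X) (c : affine_chart U) S : Prop :=
  forall p v, S (chart_map c p) v -> exists a, ~ prime_set p a /\
    forall q, S (chart_map c q) (gval (chart_sect c a) *: v).

Definition qcoh_family S : Prop :=
  stalk_family S /\ forall (U : opens X) (c : affine_chart U), qcoh_at c S.

Lemma stalk_family_opp S x v : stalk_family S -> S x v -> S x (- v).
Proof.
move=> fS Sv; have [_ _ SZ] := fS x.
have := SZ (Opens openT) (-1) v I Sv.
by rewrite raddfN /= (gval1 (x := x)) // scaleN1r.
Qed.

Lemma stalk_family_sub S x u v : stalk_family S -> S x u -> S x v -> S x (u - v).
Proof.
move=> fS Su Sv; have [_ SD _] := fS x; apply: SD => //.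
exact: stalk_family_opp.
Qed.

Section LocalToGlobal.
Variables (S : X -> set V) (fS : stalk_family S) (U : opens X) (c : affine_chart U).
Local Notation A := (chart_ring c).
Local Notation "a %:K" := (gval (chart_sect c a)) (at level 2, format "a %:K").

Lemma chart_act (p : spec A) (a : A) v :
  S (chart_map c p) v -> S (chart_map c p) (a%:K *: v).
Proof. by have [_ _ SZ] := fS (chart_map c p); apply: SZ; exact: chart_in. Qed.

Lemma chart_cancel (p : spec A) (a : A) v :
  ~ prime_set p a -> S (chart_map c p) (a%:K *: v) -> S (chart_map c p) v.
Proof.
move=> /gval_chart_unit[Y [b [Yp ba]]] Sav.
have [_ _ SZ] := fS (chart_map c p).
by have := SZ Y b _ Yp Sav; rewrite scalerA ba scale1r.
Qed.

Fact chartKM a b : (a * b)%:K = a%:K * b%:K.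
Proof. by rewrite rmorphM gvalM. Qed.

Fact chartKD a b : (a + b)%:K = a%:K + b%:K.
Proof. by rewrite !raddfD. Qed.

Lemma colon_ideal (P : set (spec A)) v :
  ideal [set a | forall q, P q -> S (chart_map c q) (a%:K *: v)].
Proof.
split=> [q _|a b Sa Sb q Pq|a b Sb q Pq].
- by rewrite !raddf0 scale0r; have [] := fS (chart_map c q).
- rewrite chartKD scalerDl; have [_ SD _] := fS (chart_map c q).
  by apply: SD; [exact: Sa|exact: Sb].
- by rewrite chartKM -scalerA; apply: chart_act; exact: Sb.
Qed.

(** Quasi-coherence on a neighbouring chart c' holds on a basic open set D(g) of c
    inside c': the multipliers, functions on c', are fractions with denominator a
    power of g. *)
Lemma qcoh_at_near (q : spec A) (U' : opens X) (c' : affine_chart U') :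
  qcoh_at c' S -> opens_set U' (chart_map c q) ->
  exists g : A, ~ prime_set q g /\ forall (p : spec A) v,
    ~ prime_set p g -> S (chart_map c p) v ->
    exists a, ~ prime_set p a /\
      forall z : spec A, ~ prime_set z g -> S (chart_map c z) (a%:K *: v).
Proof.
move=> qc' U'q; have [g [qg gU']] := chart_basis U'q.
exists g; split=> // p v pg Sv.
have gp : opens_set (chart_basic g) (chart_map c p) by apply/chart_basicE.
have [p' p'E] := chart_onto c' (gU' _ gp).
rewrite p'E in Sv; have [b [p'b bv]] := qc' p' v Sv.
have [_ frac _] := chart_basic_loc g.
have [n [a /= aE]] := frac (res gU' (chart_sect c' b)).
have aK : a%:K = g%:K ^+ n * gval (chart_sect c' b).
  rewrite -(gval_res (@chart_basic_sub _ _ c g) _ gp) -aE gvalM.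
  by rewrite (gval_res gU' _ gp) (gvalX _ _ gp) (gval_res _ _ gp).
exists a; split=> [|z zg].
  pose Y := opensI (chart_basic g) (chart_basic b).
  have YU : Y `<=` U by move=> y [/chart_basic_sub].
  have Yp : opens_set Y (chart_map c p).
    by split=> //; rewrite p'E; apply/chart_basicE.
  have [gi giE] := chart_unit g; have [bi biE] := chart_unit b.
  have Yg := @opensIl _ (chart_basic g) (chart_basic b).
  have Yb := @opensIr _ (chart_basic g) (chart_basic b).
  apply: (chart_nonvanish (YU := YU) (u := res Yg gi ^+ n * res Yb bi) Yp).
  rewrite -(res_comp (@chart_basic_sub _ _ c g) Yg) -aE rmorphM rmorphXn.
  rewrite (res_comp gU' Yg (subset_trans Yb (@chart_basic_sub _ _ c' b))).
  rewrite -(res_comp (@chart_basic_sub _ _ c' b) Yb) mulrACA -exprMn -!rmorphM.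
  by rewrite giE biE !rmorph1 expr1n mulr1.
have gz : opens_set (chart_basic g) (chart_map c z) by apply/chart_basicE.
have [z' z'E] := chart_onto c' (gU' _ gz).
have : S (chart_map c z) (gval (chart_sect c' b) *: v) by rewrite z'E.
rewrite aK -scalerA; elim: (n) => [|m IH] Sw; first by rewrite expr0 scale1r.
by rewrite exprS -scalerA; apply: chart_act; exact: IH.
Qed.

(** The functions a such that some multiple of v, by a function outside p, is a
    section over D(a) form an ideal.  By hypothesis it is contained in no prime q:
    near q, a multiple of v is a section over D(g) after multiplication by a
    power of [f * g], where D(f) is a neighbourhood of p.  So it contains 1. *)
Lemma qcoh_at_glue :
  (forall q : spec A, exists (U' : opens X) (c' : affine_chart U'),
     opens_set U' (chart_map c q) /\ qcoh_at c' S) ->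
  qcoh_at c S.
Proof.
move=> loc p v Sv.
pose J := [set a : A | exists b, ~ prime_set p b /\
  forall z : spec A, ~ prime_set z a -> S (chart_map c z) (b%:K *: v)].
have iJ : ideal J.
  split.
  - by exists 1; split=> [|z z0]; [exact: prime1|case: z0; exact: prime0].
  - move=> a a' [b [pb bv]] [b' [pb' b'v]]; exists (b * b').
    split=> [|z zaa']; first exact: nprimeM.
    have [za|za] := pselect (prime_set z a).
      rewrite chartKM -scalerA; apply/chart_act/b'v => za'.
      by apply: zaa'; exact: primeD.
    by rewrite mulrC chartKM -scalerA; apply/chart_act/bv.
  - move=> a b [d [pd dv]]; exists d; split=> // z zab; apply: dv => zb.
    by apply: zab; exact: primeM.
suff [n] : exists n, J (1 ^+ n).
  rewrite expr1n => -[b [pb bv]]; exists b; split=> // q.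
  by apply: bv; exact: prime1.
apply: power_in_ideal => // q _.
have [Up [cp [Upp qcp]]] := loc p; have [gp [pgp gpP]] := qcoh_at_near qcp Upp.
have [a [pa av]] := gpP p v pgp Sv.
have [Uq [cq [Uqq qcq]]] := loc q; have [g [qg gP]] := qcoh_at_near qcq Uqq.
exists g; split=> //; pose f := a * gp.
have iI := colon_ideal [set z | ~ prime_set z g] (a%:K *: v).
have [|n In] := power_in_ideal iI (f := f * g).
  move=> y yfg.
  have yg : ~ prime_set y g by move=> yg; apply: yfg; exact: primeM.
  have ygp : ~ prime_set y gp.
    by move=> ygp; apply: yfg; rewrite mulrC; apply: primeM; exact: primeM.
  have [r [yr rP]] := gP y _ yg (av y ygp).
  by exists r; split.
exists (f ^+ n * a); split; first by apply: nprimeM => //; apply/nprimeX/nprimeM.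
move=> z zg; apply: (@chart_cancel z (g ^+ n)); first exact: nprimeX.
by rewrite scalerA -chartKM mulrA -exprMn [g * f]mulrC chartKM -scalerA; exact: In.
Qed.

End LocalToGlobal.

(** The analogue for families of the theorem that a quasi-coherent sheaf is given
    by a module on every affine open set.  It allows families with different
    charts to be added, intersected and compared. *)
Lemma qcoh_family_local S : stalk_family S ->
  (forall x, exists (U : opens X) (c : affine_chart U),
     opens_set U x /\ qcoh_at c S) ->
  qcoh_family S.
Proof. by move=> fS loc; split=> // U c; apply: qcoh_at_glue. Qed.

Lemma qcoh_inter S T : qcoh_family S -> qcoh_family T ->
  qcoh_family (fun x => S x `&` T x).
Proof.
move=> [fS qS] [fT qT]; split.
  move=> x; have [S0 SD SZ] := fS x; have [T0 TD TZ] := fT x.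
  split=> // [u v [Su Tu] [Sv Tv]|U a v Ux [Sv Tv]].
    by split; [exact: SD|exact: TD].
  by split; [exact: SZ|exact: TZ].
move=> U c p v [Sv Tv]; have [a [pa av]] := qS U c p v Sv.
have [b [pb bv]] := qT U c p v Tv; exists (a * b); split; first exact: nprimeM.
move=> q; split; rewrite chartKM -scalerA.
  by rewrite scalerA mulrC -scalerA; exact: (chart_act fS).
exact: (chart_act fT).
Qed.

(** Directed unions are enough for Zorn's lemma and for largest subfamilies. *)
Lemma qcoh_bigcup (P : set (X -> set V)) : P !=set0 ->
  (forall S, P S -> qcoh_family S) ->
  (forall S S', P S -> P S' -> exists2 T, P T & forall x, S x `|` S' x `<=` T x) ->
  qcoh_family (fun x => \bigcup_(S in P) S x).
Proof.
move=> [S0 PS0] qP dirP; split=> [x|U c p v [S PS Sv]]; last first.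
  have [_ qS] := qP _ PS; have [a [pa av]] := qS U c p v Sv.
  by exists a; split=> // q; exists S.
split.
- by exists S0 => //; have [fS _] := qP _ PS0; have [] := fS x.
- move=> u v [S PS Su] [S' PS' S'v]; have [T PT ST] := dirP S S' PS PS'.
  exists T => //; have [fT _] := qP _ PT; have [_ TD _] := fT x.
  by apply: TD; apply: ST; [left|right].
- move=> U a v Ux [S PS Sv]; exists S => //.
  by have [fS _] := qP _ PS; have [_ _ SZ] := fS x; exact: SZ.
Qed.

Lemma qcoh_const (W : set V) : W 0 -> (forall u v, W u -> W v -> W (u + v)) ->
  (forall k v, W v -> W (k *: v)) -> qcoh_family (fun=> W).
Proof.
move=> W0 WD WZ; split=> [x|U c p v Wv]; first by split=> // U a v _; exact: WZ.
by exists 1; split=> [|q]; [exact: prime1|exact: WZ].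
Qed.

End Families.

Lemma qcoh_image (V V' : lmodType function_field) (f : V -> V') (S : X -> set V) :
  linear f -> qcoh_family S -> qcoh_family (fun x => f @` S x).
Proof.
move=> linf [fS qS].
have f0 : f 0 = 0.
  by have /eqP := linf 1 0 0; rewrite scaler0 addr0 scale1r -subr_eq subrr => /eqP.
have fD u v : f (u + v) = f u + f v by rewrite -[u in LHS]scale1r linf scale1r.
have fZ k v : f (k *: v) = k *: f v by rewrite -[k *: v]addr0 linf f0 addr0.
split=> [x|U c p _ [v Sv <-]].
  have [S0 SD SZ] := fS x; split; first by exists 0.
  - by move=> _ _ [u Su <-] [v Sv <-]; exists (u + v); [exact: SD|].
  - by move=> U a _ Ux [v Sv <-]; exists (gval a *: v); [exact: SZ|].
have [a [pa av]] := qS U c p v Sv; exists a; split=> // q.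
by exists (gval (chart_sect c a) *: v).
Qed.

Lemma qcoh_preimage (V V' : lmodType function_field) (f : {linear V -> V'})
    (S : X -> set V') :
  qcoh_family S -> qcoh_family (fun x => f @^-1` S x).
Proof.
move=> [fS qS]; split=> [x|U c p v Sv].
  have [S0 SD SZ] := fS x; split=> [|u v Su Sv|U a v Ux Sv].
  - by rewrite /preimage /= linear0.
  - by rewrite /preimage /= linearD; exact: SD.
  - by rewrite /preimage /= linearZ; exact: SZ.
have [a [pa av]] := qS U c p (f v) Sv; exists a; split=> // q.
by rewrite /preimage /= linearZ; exact: av.
Qed.

Lemma qcoh_prod (V V' : lmodType function_field) (S : X -> set V) (S' : X -> set V') :
  qcoh_family S -> qcoh_family S' -> qcoh_family (fun x => S x `*` S' x).
Proof.
move=> [fS qS] [fS' qS']; split=> [x|U c p [v v'] [/= Sv S'v']].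
  have [S0 SD SZ] := fS x; have [S'0 S'D S'Z] := fS' x.
  split=> // [u v [Su S'u] [Sv S'v]|U a v Ux [Sv S'v]].
    by split; [exact: SD|exact: S'D].
  by split; [exact: SZ|exact: S'Z].
have [a [pa av]] := qS U c p v Sv; have [b [pb bv]] := qS' U c p v' S'v'.
exists (a * b); split; first exact: nprimeM.
move=> q; split=> /=; rewrite chartKM -scalerA.
  by rewrite scalerA mulrC -scalerA; exact: (chart_act fS).
exact: (chart_act fS').
Qed.

Lemma qcoh_sum (V : lmodType function_field) (S T : X -> set V) :
  qcoh_family S -> qcoh_family T ->
  qcoh_family (fun x => (fun z : V * V => z.1 + z.2) @` (S x `*` T x)).
Proof.
move=> qS qT; apply: qcoh_image (qcoh_prod qS qT).
by move=> a u v /=; rewrite scalerDr addrACA.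
Qed.

End GenericPoint.

(** * The universal vector space over a quasi-coherent sheaf *)

Section AdditiveDual.
Variable K : comPzRingType.

Record additive_dual := AdditiveDual {
  dual_fun :> K -> QmodZ;
  dual_additive : zmod_morphism dual_fun }.

HB.instance Definition _ := gen_eqMixin additive_dual.
HB.instance Definition _ := gen_choiceMixin additive_dual.

Lemma additive_dual_eq (f g : additive_dual) : f =1 g -> f = g.
Proof.
case: f g => [f fD] [g gD] /= /funext fg; subst g.
by rewrite (Prop_irrelevance fD gD).
Qed.

HB.instance Definition _ (f : additive_dual) :=
  GRing.isZmodMorphism.Build K QmodZ (dual_fun f) (dual_additive f).

Fact dual0_additive : zmod_morphism ((fun=> 0) : K -> QmodZ).
Proof. by move=> x y; rewrite subr0. Qed.

Fact dualD_additive (f g : additive_dual) : zmod_morphism (fun x => f x + g x).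
Proof. by move=> x y; rewrite !raddfB opprD addrACA. Qed.

Fact dualN_additive (f : additive_dual) : zmod_morphism (fun x => - f x).
Proof. by move=> x y; rewrite raddfB opprD. Qed.

Fact dualZ_additive (k : K) (f : additive_dual) : zmod_morphism (fun x => f (k * x)).
Proof. by move=> x y; rewrite mulrBr raddfB. Qed.

Definition dual0 := AdditiveDual dual0_additive.
Definition dualD f g := AdditiveDual (dualD_additive f g).
Definition dualN f := AdditiveDual (dualN_additive f).
Definition dualZ k f := AdditiveDual (dualZ_additive k f).

Fact dualDA : associative dualD.
Proof. by move=> f g h; apply: additive_dual_eq => x /=; rewrite addrA. Qed.
Fact dualDC : commutative dualD.
Proof. by move=> f g; apply: additive_dual_eq => x /=; rewrite addrC. Qed.
Fact dualD0 : left_id dual0 dualD.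
Proof. by move=> f; apply: additive_dual_eq => x /=; rewrite add0r. Qed.
Fact dualDN : left_inverse dual0 dualN dualD.
Proof. by move=> f; apply: additive_dual_eq => x /=; rewrite addNr. Qed.

HB.instance Definition _ := GRing.isZmodule.Build additive_dual dualDA dualDC dualD0 dualDN.

Fact dualZA k l f : dualZ k (dualZ l f) = dualZ (k * l) f.
Proof. by apply: additive_dual_eq => x /=; rewrite mulrA [l * k]mulrC. Qed.
Fact dual1Z : left_id 1 dualZ.
Proof. by move=> f; apply: additive_dual_eq => x /=; rewrite mul1r. Qed.
Fact dualZDr : right_distributive dualZ +%R.
Proof. by move=> k f g; apply: additive_dual_eq. Qed.
Fact dualZDl f : {morph dualZ^~ f : k l / k + l}.
Proof. by move=> k l; apply: additive_dual_eq => x /=; rewrite mulrDl raddfD. Qed.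

HB.instance Definition _ :=
  GRing.Zmodule_isLmodule.Build K additive_dual dualZA dual1Z dualZDr dualZDl.

End AdditiveDual.

Section QcohCharts.
Variables (X : scheme) (F : moduleSheaf X).

(** The charts provided by quasi-coherence. *)
Definition presents (U : opens X) (c : affine_chart U) (M0 : lmodType (chart_ring c))
    (g : {linear M0 -> F U | chart_sect c \; *:%R}) : Prop :=
  forall (f : chart_ring c) (V : opens X) (VU : V `<=` U),
    chart_map c @` basic_open f = V :> set X ->
    localizes_module f (res VU \o chart_sect c) (mres F VU \o g).

Variables (U : opens X) (c : affine_chart U).
Variables (M0 : lmodType (chart_ring c)) (g : {linear M0 -> F U | chart_sect c \; *:%R}).
Hypothesis gP : presents g.

Lemma presents_onto (m : F U) : exists m0, m = g m0.
Proof.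
have [_ frac _] := gP (@chart_basic_sub _ _ c 1) erefl.
have [n [m0 /= m0E]] := frac (mres F (@chart_basic_sub _ _ c 1) m).
move: m0E; rewrite !rmorph1 expr1n scale1r => m0E.
have U1 : U `<=` chart_basic (1 : chart_ring c).
  by move=> _ /(chart_onto c)[p ->]; apply/chart_basicE; exact: prime1.
exists m0; have back y := mres_comp (@chart_basic_sub _ _ c 1) U1 (@subset_refl _ U) y.
by rewrite -(mres_id (@subset_refl _ U) m) -back m0E back mres_id.
Qed.

Lemma presents_torsion (m : F U) f :
  mres F (@chart_basic_sub _ _ c f) m = 0 -> exists n, chart_sect c (f ^+ n) *: m = 0.
Proof.
have [m0 ->] := presents_onto m => m0f.
have [_ _ inj] := gP (@chart_basic_sub _ _ c f) erefl.
have [|n fn] := inj m0 0; first by rewrite /= m0f !raddf0.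
by exists n; have := linearZ_LR g (f ^+ n) m0; rewrite /= fn scaler0 raddf0 => <-.
Qed.

End QcohCharts.

Section Universal.
Variables (X : scheme) (intX : integral_scheme X).
Local Notation eta := (generic intX).
Local Notation K := (function_field intX).
Local Notation kap := (gval intX).
Local Notation to_eta := (generic_in intX).

Lemma qcoh_nbhd (V : lmodType K) (S : X -> set V) x v : qcoh_family S -> S x v ->
  exists Y : opens X, opens_set Y x /\ forall y, opens_set Y y -> S y v.
Proof.
move=> [fS qS] Sv; have [U [Ux [c]]] := scheme_affine x.
have [p xE] := chart_onto c Ux; rewrite xE in Sv *.
have [a [pa av]] := qS U c p v Sv; exists (chart_basic a); split; first exact/chart_basicE.
by move=> _ [q qa <-]; apply: (chart_cancel fS qa).
Qed.

Definition largest (V : lmodType K) (B : X -> set V) (x : X) : set V :=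
  \bigcup_(S in [set S | qcoh_family S /\ forall y, S y `<=` B y]) S x.

Lemma largest_max (V : lmodType K) (B S : X -> set V) :
  qcoh_family S -> (forall y, S y `<=` B y) -> forall x, S x `<=` largest B x.
Proof. by move=> qS SB x v Sv; exists S. Qed.

Lemma largest_sub (V : lmodType K) (B : X -> set V) x : largest B x `<=` B x.
Proof. by move=> v [S [_ SB] /SB]. Qed.

Lemma qcoh_largest (V : lmodType K) (B : X -> set V) :
  stalk_family B -> qcoh_family (largest B).
Proof.
move=> fB; apply: qcoh_bigcup.
- exists (fun=> [set 0]); split; last by move=> y _ ->; have [] := fB y.
  apply: qcoh_const => // [u v -> ->|k v ->]; first by rewrite /= addr0.
  by rewrite /= scaler0.
- by move=> S [].
- move=> S S' [qS SB] [qS' S'B]; have [[fS _] [fS' _]] := (qS, qS').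
  exists (fun x => (fun z : V * V => z.1 + z.2) @` (S x `*` S' x)).
    split; first exact: qcoh_sum.
    move=> y _ [[u v] [/= Su S'v] <-]; have [_ BD _] := fB y.
    by apply: BD; [exact: SB|exact: S'B].
  move=> x v [Sv|S'v]; have [S0 _ _] := fS x; have [S'0 _ _] := fS' x.
    by exists (v, 0); rewrite /= ?addr0.
  by exists (0, v); rewrite /= ?add0r.
Qed.

(** The image of F in the constant sheaf given by its generic stalk. *)
Definition generic_stalks (F : moduleSheaf X) (x : X) : set (stalk_mod F eta) :=
  [set t | exists (U : opens X) (Ux : opens_set U x) (s : F U),
    t = mgerm (to_eta Ux) s].
Arguments generic_stalks : clear implicits.

Lemma qcoh_generic_stalks (F : moduleSheaf X) : quasi_coherent F ->
  qcoh_family (V := stalk_mod F eta) (generic_stalks F).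
Proof.
move=> qF; apply: qcoh_family_local.
  move=> x; split.
  - by exists (Opens openT), I, 0; rewrite raddf0.
  - move=> _ _ [U [Ux [s ->]]] [V [Vx [t ->]]].
    have Wx : opens_set (opensI U V) x by [].
    exists (opensI U V), Wx, (mres F (@opensIl _ U V) s + mres F (@opensIr _ U V) t).
    by rewrite raddfD /= (mgerm_res (to_eta Ux)) (mgerm_res (to_eta Vx)).
  - move=> U a _ Ux [V [Vx [s ->]]].
    have Wx : opens_set (opensI U V) x by [].
    exists (opensI U V), Wx, (res (@opensIl _ U V) a *: mres F (@opensIr _ U V) s).
    by rewrite mgermZ (rgerm_res (to_eta Ux)) (mgerm_res (to_eta Vx)) -gvalE.
move=> x; have [U [c [Ux [M0 [g gP]]]]] := qF x; exists U, c; split=> //.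
move=> p _ [V [Vp [s ->]]]; have [f [pf fV]] := chart_basis Vp.
have [_ frac _] := gP f (chart_basic f) (@chart_basic_sub _ _ c f) erefl.
have [n [m0 /= m0E]] := frac (mres F fV s).
exists (f ^+ n); split=> [|q]; first exact: nprimeX.
exists U, (chart_in q), (g m0).
have fp : opens_set (chart_basic f) (chart_map c p) by apply/chart_basicE.
rewrite -(mgerm_res (to_eta (chart_in q)) (to_eta fp) (@chart_basic_sub _ _ c f)).
rewrite -m0E mgermZ (mgerm_res (to_eta Vp)); congr (_ *: _).
rewrite -(gvalE (intX := intX)) -rmorphXn (gval_res intX _ _ fp); congr (kap _).
by rewrite rmorphXn.
Qed.

(** After multiplication by a function that does not vanish at x, the germ of s
    extends to a chart; there it is killed by a nonzero function, hence zero. *)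
Lemma torsion_free_germ (F : qcohSheaf X) : locally_torsion_free F ->
  forall x (U : opens X) (Ux : opens_set U x) (s : F U),
    mgerm (to_eta Ux) s = 0 -> mgerm Ux s = 0.
Proof.
move=> tfF x U Ux s s0.
have [U' [c [U'x [M0 [g gP]]]]] := qcohP F x.
have [p xE] := chart_onto c U'x; move: Ux U'x s0; rewrite xE => Ux U'x s0.
have [f [pf fU]] := chart_basis Ux.
have fp : opens_set (chart_basic f) (chart_map c p) by apply/chart_basicE.
have [_ frac _] := gP f (chart_basic f) (@chart_basic_sub _ _ c f) erefl.
have [n [m0 /= m0E]] := frac (mres F fU s).
have tf : torsion_free (F U').
  by apply: tfF; [exists (chart_map c p)|exact: (inhabits c)].
have g0 : mgerm (to_eta U'x) (g m0) = 0.
  rewrite -(mgerm_res (to_eta U'x) (to_eta fp) (@chart_basic_sub _ _ c f)).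
  by rewrite -m0E mgermZ (mgerm_res (to_eta Ux)) s0 scaler0.
have gm0 : g m0 = 0.
  have [W [WU' [Weta W0]]] := mgerm_eq0 g0.
  have [q etaE] := chart_onto c (to_eta U'x).
  rewrite etaE in Weta; have [h [qh hW]] := chart_basis Weta.
  have [|k hk] := presents_torsion gP (m := g m0) (f := h).
    by rewrite -(mres_comp WU' hW) W0 raddf0.
  have [h0|//] := tf _ _ hk; exfalso; apply: (nprime_neq0 (nprimeX (n := k) qh)).
  exact: chart_sect_inj h0.
rewrite gm0 raddf0 in m0E.
rewrite -(mgerm_res Ux fp fU) -[mres F fU s]scale1r.
have [fi fiE] := chart_unit f.
have -> : 1 = fi ^+ n * res (@chart_basic_sub _ _ c f) (chart_sect c f) ^+ n.
  by rewrite -exprMn mulrC fiE expr1n.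
by rewrite -scalerA m0E scaler0 raddf0.
Qed.

Section OverM.
Variable M : moduleSheaf X.

Record character := Character {
  ch_point : X;
  ch_fun :> stalk_mod M ch_point -> QmodZ;
  ch_additive : zmod_morphism ch_fun }.
Arguments ch_fun : clear implicits.
Arguments ch_additive : clear implicits.

HB.instance Definition _ (chi : character) :=
  GRing.isZmodMorphism.Build (stalk_mod M (ch_point chi)) QmodZ (ch_fun chi)
    (ch_additive chi).

(** The stalk of M at x embeds, by its characters chi, in the product of the
    injective modules of additive maps from the local ring at x to Q/Z.  The
    maps from a vector space over the function field K to the product E of the
    skyscraper sheaves obtained in this way are the linear maps to this space. *)
Definition universal_space : lmodType K := (character -> additive_dual K).
Local Notation V := universal_space.

Lemma universal_map (W : lmodType K) (e : character -> W -> QmodZ) :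
  (forall chi, zmod_morphism (e chi)) ->
  exists h : {linear W -> V}, forall w chi k, h w chi k = e chi (k *: w).
Proof.
move=> eD; have hD w chi : zmod_morphism (fun k => e chi (k *: w)).
  by move=> k l; rewrite scalerBl; exact: eD.
pose h (w : W) : V := fun chi => AdditiveDual (hD w chi).
have hlin : linear h.
  move=> a u w; apply/funext => chi; apply: additive_dual_eq => k /=.
  pose eA : {additive W -> QmodZ} :=
    HB.pack (e chi) (GRing.isZmodMorphism.Build W QmodZ (e chi) (eD chi)).
  rewrite -[LHS]/(eA (k *: (a *: u + w))) scalerDr raddfD scalerA mulrC.
  by [].
pose hL : {linear W -> V} := HB.pack h (GRing.isLinear.Build K W V *:%R h hlin).
by exists hL.
Qed.

(** The map from K to E given by v sends 1 to the image of m, in E over U. *)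
Definition lifts (U : opens X) (v : V) (m : M U) : Prop :=
  forall (chi : character) (Y : opens X) (YU : Y `<=` U)
    (Yx : opens_set Y (ch_point chi)) (r : sect Y),
    v chi (kap r) = chi (mgerm Yx (r *: mres M YU m)).

Lemma lifts_res (U W : opens X) (WU : W `<=` U) v (m : M U) :
  lifts v m -> lifts v (mres M WU m).
Proof.
move=> vm chi Y YW Yx r; rewrite (mres_comp _ _ (subset_trans YW WU)).
exact: vm.
Qed.

Lemma lifts_linear (U : opens X) (a : sect U) v w (m n : M U) :
  lifts v m -> lifts w n -> lifts (kap a *: v + w) (a *: m + n).
Proof.
move=> vm wn chi Y YU Yx r.
rewrite -[LHS]/(v chi (kap a * kap r) + w chi (kap r)).
rewrite linearD scalerDr !raddfD /= linearZ_LR /= scalerA (wn _ _ YU Yx).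
by rewrite mulrC -(gval_res intX YU a Yx) -gvalM (vm _ _ YU Yx).
Qed.

Lemma lifts0 (U : opens X) : lifts 0 (0 : M U).
Proof.
by move=> chi Y YU Yx r; rewrite linear0 scaler0 raddf0 /= raddf0.
Qed.

Lemma character_separates x (s : stalk_mod M x) : s <> 0 ->
  exists chi : stalk_mod M x -> QmodZ, zmod_morphism chi /\ chi s <> 0.
Proof. exact: (additive_separation QmodZ_divisible). Qed.

Lemma lifts_germ_eq0 (U : opens X) x (Ux : opens_set U x) v (m : M U) : lifts v m ->
  (forall (chi : character), ch_point chi = x -> v chi 1 = 0) -> mgerm Ux m = 0.
Proof.
move=> vm v0; apply: contrapT => /character_separates[chi [chiD chim]].
apply: chim; have := v0 (Character chiD) erefl.
rewrite -(gval1 intX Ux) (vm (Character chiD) U (@subset_refl _ U) Ux).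
by rewrite scale1r mres_id.
Qed.

Lemma lifts_uniq (U : opens X) v (m n : M U) : lifts v m -> lifts v n -> m = n.
Proof.
move=> vm vn; apply/eqP; rewrite -subr_eq0; apply/eqP.
have vmn : lifts (0 : V) (m - n).
  have := lifts_linear (-1) vn vm; rewrite scaleN1r [- n + m]addrC => h.
  move=> chi Y YU Yx r; rewrite -(h chi Y YU Yx r).
  have -> : kap (-1 : sect U) = -1 by rewrite raddfN /= (gval1 intX (YU _ Yx)).
  by rewrite scaleN1r addNr.
apply: (sheaf_separated (@mres_sheaf X M)) => x Ux.
have [W [WU [Wx W0]]] : exists (W : opens X) (WU : W `<=` U),
    opens_set W x /\ mres M WU (m - n) = 0.
  by apply: mgerm_eq0 (lifts_germ_eq0 Ux vmn _).
by exists W, WU; rewrite W0 raddf0.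
Qed.

Lemma lifts_glue (U : opens X) v :
  (forall x, opens_set U x -> exists (W : opens X) (m : M W), opens_set W x /\ lifts v m) ->
  exists m : M U, lifts v m.
Proof.
move=> loc; pose C := [set W : opens X | W `<=` U /\ exists m : M W, lifts v m].
have [|sep glue] := @mres_sheaf X M U C.
  apply/seteqP; split=> [x [W [WU _] /WU//]|x Ux].
  have [W [m [Wx vm]]] := loc x Ux; exists (opensI U W) => //; split.
    exact: opensIl.
  by exists (mres M (@opensIr _ U W) m); exact: lifts_res.
have sP (W : opens X) : {m : M W | C W -> lifts v m}.
  apply: cid; have [[_ [m vm]]|nC] := pselect (C W); first by exists m.
  by exists 0.
have [|m mE] := glue (fun W => sval (sP W)).
  by move=> Y Z CY CZ; apply: lifts_uniq; apply: lifts_res; exact: (svalP (sP _)).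
exists m => chi Y YU Yx r.
have [W [n [Wx vn]]] := loc _ (YU _ Yx).
pose Z := opensI Y W; have ZY := @opensIl _ Y W; have ZW := @opensIr _ Y W.
have Zx : opens_set Z (ch_point chi) by [].
have CZ : C Z.
  split; first exact: subset_trans ZY YU.
  by exists (mres M ZW n); exact: lifts_res.
rewrite -(mgerm_res Yx Zx ZY) linearZ_LR /= (mres_comp _ _ (subset_trans ZY YU)).
rewrite (mE Z _ CZ) -(gval_res intX ZY _ Zx).
have := svalP (sP Z) CZ chi Z (@subset_refl _ Z) Zx (res ZY r).
by rewrite mres_id.
Qed.

(** The stalks of the inverse images of M and of 0 under the map from the constant
    sheaf V to E; these inverse images need not be quasi-coherent. *)
Definition lift_family (x : X) : set V :=
  [set v | exists (U : opens X) (m : M U), opens_set U x /\ lifts v m].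

Definition null_family (x : X) : set V :=
  [set v | forall (chi : character) (Y : opens X) (Yx : opens_set Y (ch_point chi))
     (r : sect Y), ch_point chi = x -> v chi (kap r) = 0].

Fact lift_family_stalk : stalk_family lift_family.
Proof.
move=> x; split.
- by exists (Opens openT), 0; split=> //; exact: lifts0.
- move=> u v [U [m [Ux um]]] [W [n [Wx vn]]].
  exists (opensI U W), (mres M (@opensIl _ U W) m + mres M (@opensIr _ U W) n); split=> //.
  have Yx : opens_set (opensI U W) x by [].
  rewrite -[mres M _ m]scale1r -[u]scale1r -(gval1 intX Yx).
  by apply: lifts_linear; exact: lifts_res.
- move=> U a v Ux [W [m [Wx vm]]].
  have Yx : opens_set (opensI U W) x by [].
  exists (opensI U W), (res (@opensIl _ U W) a *: mres M (@opensIr _ U W) m + 0).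
  split=> //; rewrite -[_ *: v]addr0 -(gval_res intX (@opensIl _ U W) _ Yx).
  by apply: lifts_linear; [exact: lifts_res|exact: lifts0].
Qed.

Fact null_family_stalk : stalk_family null_family.
Proof.
move=> x; split=> [//|u v u0 v0 chi Y Yx r chix|U a v Ux v0 chi Y Yx r chix].
  have uE := u0 chi Y Yx r chix; have vE := v0 chi Y Yx r chix.
  by rewrite -[LHS]/(u chi (kap r) + v chi (kap r)) uE vE addr0.
rewrite -[LHS]/(v chi (kap a * kap r)).
have Ux' : opens_set U (ch_point chi) by rewrite chix.
have Zx : opens_set (opensI U Y) (ch_point chi) by [].
rewrite -(gval_res intX (@opensIl _ U Y) _ Zx) -(gval_res intX (@opensIr _ U Y) _ Zx).
by rewrite -gvalM; exact: v0.
Qed.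

(** The values of v at all of K are the values at 1 of its multiples. *)
Lemma null_family_reduced v : (forall k x, null_family x (k *: v)) -> v = 0.
Proof.
move=> v0; apply/funext => chi; apply: additive_dual_eq => k.
have := v0 k (ch_point chi) chi (Opens openT) I 1 erefl.
by rewrite (gval1 intX (x := eta)) // -[LHS]/(v chi (k * 1)) mulr1.
Qed.

Definition cover_family : X -> set V := largest lift_family.
Definition kernel_family : X -> set V := largest null_family.

Lemma qcoh_cover_family : qcoh_family cover_family.
Proof. exact: qcoh_largest lift_family_stalk. Qed.

Lemma qcoh_kernel_family : qcoh_family kernel_family.
Proof. exact: qcoh_largest null_family_stalk. Qed.

Lemma kernel_reduced v : (forall k x, kernel_family x (k *: v)) -> v = 0.
Proof.
by move=> v0; apply: null_family_reduced => k x; exact: largest_sub (v0 k x).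
Qed.

Lemma kernel_lifts0 (U : opens X) v :
  (forall x, opens_set U x -> kernel_family x v) -> lifts v (0 : M U).
Proof.
move=> v0 chi Y YU Yx r; rewrite linear0 scaler0 raddf0 /= raddf0.
exact: (largest_sub (v0 _ (YU _ Yx)) chi Y Yx r erefl).
Qed.

Lemma kernel_sub_cover x : kernel_family x `<=` cover_family x.
Proof.
apply: largest_max; first exact: qcoh_kernel_family.
move=> y v Nv; have [Y [Yy YN]] := qcoh_nbhd qcoh_kernel_family Nv.
by exists Y, 0; split=> //; exact: kernel_lifts0.
Qed.

Lemma cover_lifts (U : opens X) v :
  (forall x, opens_set U x -> cover_family x v) -> exists m : M U, lifts v m.
Proof.
move=> Fv; apply: lifts_glue => x Ux.
by have [W [m [Wx vm]]] := largest_sub (Fv x Ux); exists W, m.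
Qed.

Hypothesis qM : quasi_coherent M.

(** The kernel of the map from [cover_family] to M is quasi-coherent because M is. *)
Lemma kernel_familyE x v : cover_family x v -> null_family x v -> kernel_family x v.
Proof.
move=> Fv Zv; have [fF qF] := qcoh_cover_family; have fZ := null_family_stalk.
suff qFZ : qcoh_family (fun x => cover_family x `&` null_family x).
  by apply: (largest_max qFZ); [move=> y w []|split].
apply: qcoh_family_local => [y|y].
  have [F0 FD FZ] := fF y; have [Z0 ZD ZZ] := fZ y.
  split=> // [u w [Fu Zu] [Fw Zw]|U a w Uy [Fw Zw]].
    by split; [exact: FD|exact: ZD].
  by split; [exact: FZ|exact: ZZ].
have [U [c [Uy [M0 [g gP]]]]] := qM y; exists U, c; split=> //.
move=> p w [Fw Zw]; have [a [pa aw]] := qF U c p w Fw.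
have [|m aw_m] := @cover_lifts U (kap (chart_sect c a) *: w).
  by move=> z /(chart_onto c)[q ->]; exact: aw.
have m0 : mgerm (chart_in p) m = 0.
  apply: lifts_germ_eq0 aw_m _ => chi chip.
  have Up : opens_set U (ch_point chi) by rewrite chip; exact: chart_in.
  by have := chart_act fZ a Zw chi U Up 1 chip; rewrite (gval1 intX Up).
have [W [WU [Wp W0]]] := mgerm_eq0 m0; have [f [pf fW]] := chart_basis Wp.
have [|n fn] := presents_torsion gP (m := m) (f := f).
  by rewrite -(mres_comp WU fW) W0 raddf0.
exists (f ^+ n * a); split=> [|q]; first by apply: nprimeM => //; exact: nprimeX.
rewrite (chartKM intX) -scalerA; split; first exact: (chart_act fF).
have fnaw : lifts (kap (chart_sect c (f ^+ n)) *: (kap (chart_sect c a) *: w)) (0 : M U).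
  rewrite -fn -[X in lifts X _]addr0 -[X in lifts _ X]addr0.
  by apply: lifts_linear => //; exact: lifts0.
move=> chi Y Yx r chiq.
have Ux : opens_set U (ch_point chi) by rewrite chiq; exact: chart_in.
have Zx : opens_set (opensI U Y) (ch_point chi) by [].
rewrite -(gval_res intX (@opensIr _ U Y) r Zx) (fnaw _ _ (@opensIl _ U Y) Zx).
by rewrite linear0 scaler0 raddf0 /= raddf0.
Qed.

(** Injectivity of V modulo the kernel: a map to it from a quasi-coherent
    subfamily of V, here the relation Gamma, extends to V.  Each character extends
    separately, as an additive map to Q/Z.  The difference between the extension
    and Gamma is null, and quasi-coherent as an image of Gamma, so it lies in the
    largest quasi-coherent null family. *)
Lemma relative_injectivity (Gamma : X -> set (V * V)) : qcoh_family Gamma ->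
  (forall x w, Gamma x (0, w) -> kernel_family x w) ->
  exists h : {linear V -> V}, forall x z, Gamma x z -> kernel_family x (h z.1 - z.2).
Proof.
move=> qG G0; have [fG _] := qG.
have /choice[e eP] : forall chi : character, exists e : V -> QmodZ, zmod_morphism e /\
    forall z, Gamma (ch_point chi) z -> e z.1 = z.2 chi 1.
  move=> chi; pose G := [set y : V * QmodZ |
    exists z, Gamma (ch_point chi) z /\ y = (z.1, z.2 chi 1)].
  have [|e [eD eG]] := additive_extension QmodZ_divisible (G := G).
    split; first split.
    - by exists 0; split=> //; have [] := fG (ch_point chi).
    - move=> _ _ [y [Gy ->]] [z [Gz ->]]; exists (y - z); split=> //.
      exact: stalk_family_sub.
    - move=> d [[v w] [Gvw [/= vE ->]]]; rewrite -vE in Gvw.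
      have := largest_sub (G0 _ _ Gvw) chi (Opens openT) I 1 erefl.
      by rewrite (gval1 intX (x := eta)).
  by exists e; split=> // z Gz; apply: eG; exists z.
have [hL hE] := universal_map (fun chi => proj1 (eP chi)).
exists hL => x z Gz.
pose d (y : V * V) : V := hL y.1 - y.2.
have dlin : linear d.
  move=> a y y'; rewrite -[LHS]/(hL (a *: y.1 + y'.1) - (a *: y.2 + y'.2)).
  by rewrite linearP /d scalerBr opprD addrACA.
have : (d @` Gamma x) (d z) by exists z.
apply: (largest_max (qcoh_image dlin qG)) => {}x _ [{Gz}z Gz <-] chi Y Yx r chix.
have Yx' : opens_set Y x by rewrite -chix.
have [_ _ GZ] := fG x.
have := GZ Y r z Yx' Gz; rewrite -chix; have [_ eG] := eP chi => /eG /= eE.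
rewrite -[LHS]/(hL z.1 chi (kap r) - z.2 chi (kap r)) hE eE.
by rewrite -[X in X - _]/(z.2 chi (kap r * 1)) mulr1 subrr.
Qed.

(** For each character at x, psi prescribes an additive map on the subgroup of the
    generic stalk of F that consists of the germs of F at x; it is well defined
    because F is torsion-free, and it extends to the whole generic stalk. *)
Lemma torsion_free_lift (F : qcohSheaf X) (psi : module_hom F M) :
  locally_torsion_free F ->
  exists h : {linear stalk_mod F eta -> V},
    forall x (U : opens X) (Ux : opens_set U x) (s : F U),
      lifts (h (mgerm (to_eta Ux) s)) (psi U s) /\
      cover_family x (h (mgerm (to_eta Ux) s)).
Proof.
move=> tfF; pose VF := stalk_mod F eta.
have psiB (U : opens X) (s t : F U) : psi U (s - t) = psi U s - psi U t.
  by rewrite addrC -scaleN1r mhom_linear scaleN1r addrC.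
have psi0 (U : opens X) : psi U 0 = 0 by rewrite -[X in psi U X](subrr 0) psiB subrr.
have psi_germ x (U : opens X) (Ux : opens_set U x) (s : F U) :
    mgerm Ux s = 0 -> mgerm Ux (psi U s) = 0.
  move=> /mgerm_eq0[W [WU [Wx W0]]].
  rewrite -(mgerm_res Ux Wx WU) mhom_natural W0 psi0.
  by rewrite raddf0.
have /choice[e eP] : forall chi : character, exists e : VF -> QmodZ, zmod_morphism e /\
    forall (U : opens X) (Ux : opens_set U (ch_point chi)) (s : F U),
      e (mgerm (to_eta Ux) s) = chi (mgerm Ux (psi U s)).
  move=> chi; pose G := [set y : VF * QmodZ |
    exists (U : opens X) (Ux : opens_set U (ch_point chi)) (s : F U),
      y = (mgerm (to_eta Ux) s, chi (mgerm Ux (psi U s)))].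
  have [|e [eD eG]] := additive_extension QmodZ_divisible (G := G).
    split; first split.
    - exists (Opens openT), I, 0; rewrite raddf0 psi_germ ?raddf0 //.
    - move=> _ _ [U [Ux [s ->]]] [W [Wx [t ->]]].
      have Yx : opens_set (opensI U W) (ch_point chi) by [].
      exists (opensI U W), Yx, (mres F (@opensIl _ U W) s - mres F (@opensIr _ U W) t).
      rewrite psiB !raddfB /= -!mhom_natural (mgerm_res (to_eta Ux)).
      by rewrite (mgerm_res (to_eta Wx)) (mgerm_res Ux) (mgerm_res Wx).
    - move=> d [U [Ux [s [/esym s0 ->]]]].
      by rewrite psi_germ ?raddf0 //; exact: torsion_free_germ s0.
  by exists e; split=> // U Ux s; apply: eG; exists U, Ux, s.
have [hL hE] := universal_map (fun chi => proj1 (eP chi)).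
have hlifts x (U : opens X) (Ux : opens_set U x) (s : F U) :
    lifts (hL (mgerm (to_eta Ux) s)) (psi U s).
  move=> chi Y YU Yx r; have [_ eG] := eP chi.
  rewrite hE -(mgerm_res (to_eta Ux) (to_eta Yx) YU) (gvalE (to_eta Yx)) -mgermZ eG.
  congr (chi (mgerm _ _)); have := mhom_linear psi (U := Y) r (mres F YU s) 0.
  by rewrite psi0 !addr0 mhom_natural.
exists hL => x U Ux s; split; first exact: hlifts.
have : (hL @` generic_stalks F x) (hL (mgerm (to_eta Ux) s)).
  by exists (mgerm (to_eta Ux) s) => //; exists U, Ux, s.
apply: (largest_max (qcoh_image (@linearP _ _ _ _ hL) (qcoh_generic_stalks (qcohP F)))).
move=> y _ [_ [W [Wy [t ->]]] <-]; exists W, (psi W t); split=> //.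
Qed.

End OverM.
End Universal.

(** * Essential kernels *)

Section Essential.
Variables (X : scheme) (intX : integral_scheme X).
Local Notation K := (function_field intX).
Variable V : lmodType K.
Implicit Types S T A C : X -> set V.

(** The complements of module theory, modulo N. *)
Lemma maximal_disjoint (N A C : X -> set V) : qcoh_family A ->
  (forall x v, A x v -> C x v -> N x v) ->
  exists L, [/\ qcoh_family L, forall x, A x `<=` L x,
    forall x v, L x v -> C x v -> N x v &
    forall T, qcoh_family T -> (forall x, L x `<=` T x) ->
      (forall x v, T x v -> C x v -> N x v) -> forall x, T x `<=` L x].
Proof.
move=> qA AC.
(* A family is encoded by a set of pairs, ordered by inclusion. *)
pose fam (B : set (X * V)) (x : X) : set V := [set v | B (x, v)].
pose P (B : set (X * V)) := qcoh_family (fam B) /\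
  forall x v, B (x, v) -> C x v -> N x v.
have [|Ch [B0 ChB0] ChP totCh|L [[qL LC] AL maxL]] :=
    @Zorn_above _ P [set z | A z.1 z.2].
- by split=> //; exact: AC.
- split; last by move=> x v [B ChB Bv]; have [_] := ChP _ ChB; apply.
  rewrite (_ : fam _ = fun x => \bigcup_(S in fam @` Ch) S x); last first.
    apply/funext => x; apply/seteqP; split=> [v [B ChB Bv]|v [_ [B ChB <-] Bv]].
      by exists (fam B) => //; exists B.
    by exists B.
  apply: qcoh_bigcup; first by exists (fam B0), B0.
    by move=> _ [B ChB <-]; have [] := ChP _ ChB.
  move=> _ _ [B ChB <-] [B' ChB' <-].
  have [BB'|B'B] := totCh _ _ ChB ChB'.
    by exists (fam B'); [exists B'|move=> x v [/BB'|]].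
  by exists (fam B); [exists B|move=> x v [|/B'B]].
exists (fam L); split=> // [x v Av|T qT LT TC x v Tv].
  exact: AL (x, v) Av.
by apply: (maxL [set z | T z.1 z.2] _ _ (x, v) Tv) => // -[y w]; exact: LT.
Qed.

Variables N F : X -> set V.
Hypotheses (qN : qcoh_family N) (qF : qcoh_family F).
Hypothesis NF : forall x, N x `<=` F x.
Hypothesis N_reduced : forall v, (forall k x, N x (k *: v)) -> v = 0.
Hypothesis inj : forall Gamma : X -> set (V * V), qcoh_family Gamma ->
  (forall x w, Gamma x (0, w) -> N x w) ->
  exists h : {linear V -> V}, forall x z, Gamma x z -> N x (h z.1 - z.2).

Let fN : stalk_family N. Proof. by case: qN. Qed.
Let fF : stalk_family F. Proof. by case: qF. Qed.

Let NB x u v : N x u -> N x v -> N x (u - v).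
Proof. exact: stalk_family_sub. Qed.
Let NN x v : N x v -> N x (- v). Proof. exact: stalk_family_opp. Qed.
Let ND x u v : N x u -> N x v -> N x (u + v).
Proof. by have [_ + _] := fN x; apply. Qed.
Let N0 x : N x 0. Proof. by have [] := fN x. Qed.
Let FB x u v : F x u -> F x v -> F x (u - v).
Proof. exact: stalk_family_sub. Qed.
Let FD x u v : F x u -> F x v -> F x (u + v).
Proof. by have [_ + _] := fF x; apply. Qed.

(** The injective hull of F/N, in the form p V / N: as in a module category, a
    complement L of F modulo N and a complement H of L that contains F add up
    to the injective object V / N, and p is the projection to H along L.  Since
    N contains no subspace of V, p is idempotent on V and not only modulo N. *)
Lemma essential_projection : exists p : {linear V -> V},
  [/\ forall v, p (p v) = p v, forall x v, F x v -> N x (p v - v) &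
      forall T, qcoh_family T -> (forall x v, T x v -> p v = v) ->
        (forall x v, T x v -> F x v -> N x v) -> forall x, T x `<=` N x].
Proof.
have [//|L [qL NL LF maxL]] := @maximal_disjoint N N F qN.
have [|H [qH FH HL maxH]] := @maximal_disjoint N F L qF.
  by move=> x v Fv Lv; exact: LF.
have [fL _] := qL; have [fH _] := qH.
(* The projection to H along L, modulo N. *)
pose Gamma x := (fun z : V * V => (z.1 + z.2, z.1)) @` (H x `*` L x).
have [||p pG] := inj (Gamma := Gamma).
- apply: qcoh_image (qcoh_prod qH qL) => a u v.
  rewrite -[RHS]/(a *: (u.1 + u.2) + (v.1 + v.2), a *: u.1 + v.1).
  by rewrite scalerDr addrACA.
- move=> x w [[u l] [/= Hu Ll] [/eqP]]; rewrite addr_eq0 => /eqP ul <-.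
  by apply: HL => //; rewrite ul; exact: stalk_family_opp.
have pH x u : H x u -> N x (p u - u).
  move=> Hu; have L0 : L x 0 by have [] := fL x.
  by have := pG x (u, u); apply; exists (u, 0); rewrite //= addr0.
have pL x l : L x l -> N x (p l).
  move=> Ll; have H0 : H x 0 by have [] := fH x.
  have := pG x (l, 0); rewrite /= subr0; apply.
  by exists (0, l); rewrite //= add0r.
pose q : {linear V -> V} := GRing.sub_fun idfun p.
have qNH x v : N x (q v) -> H x v.
  apply: (maxH _ (qcoh_preimage q qN)) => [y u Hu|y l Nl Ll].
    by rewrite /preimage /= -opprB; apply/NN/pH.
  rewrite -[l](subrK (p l)); apply: ND; first exact: Nl.
  exact: pL.
have qFH x v : F x (q v) -> H x v.
  apply: (maxH _ (qcoh_preimage q qF)) => [y u Hu|y l Fl Ll].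
    by rewrite /preimage /= -opprB; apply/NF/NN/pH.
  apply: LF => //; rewrite -[l](subrK (p l)); apply: FD; first exact: Fl.
  by apply/NF/pL.
(* The image of q is an essential extension of L, so it is contained in L. *)
have qL' x v : L x (q v).
  have qW : qcoh_family (fun _ : X => [set u | exists v, u = q v]).
    apply: qcoh_const; first by exists 0; rewrite raddf0.
    - by move=> _ _ [u ->] [w ->]; exists (u + w); rewrite raddfD.
    - by move=> k _ [u ->]; exists (k *: u); rewrite linearZ.
  have Lsum := maxL _ (qcoh_sum qW qN).
  apply: Lsum => [y l Ll|y _ [[_ n] [[u /= ->] /= Nn] <-] Fun|].
  - by exists (q l, p l); [split; [exists l|exact: pL]|rewrite /= subrK].
  - have Fu : F y (q u) by rewrite -[q u](addrK n); apply: FB => //; exact: NF.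
    apply: ND => //; rewrite /= -opprB; apply/NN/pH.
    exact: qFH.
  - by exists (q v, 0); [split; [exists v|exact: N0]|rewrite /= addr0].
exists p; split.
- move=> v; apply/eqP; rewrite eq_sym -subr_eq0 -raddfB; apply/eqP.
  apply: N_reduced => k x; rewrite -linearZ /= -[v - p v]/(q v) -linearZ.
  by apply: pL; exact: qL'.
- by move=> x v /FH /pH.
- move=> T qT Tp TF x t Tt; have [fT _] := qT.
  have TL : L x t.
    apply: (maxL _ (qcoh_sum qT qL)) => [y l Ll|y _ [[u l] [/= Tu Ll] <-] Fu|].
    - by exists (0, l); [split=> //; have [] := fT y|rewrite /= add0r].
    - have uE : u - (u + l) = p (u + l) - (u + l) - p l.
        by rewrite (raddfD p) /= (Tp _ _ Tu) addrAC addrK.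
      have Nul : N y (u - (u + l)) by rewrite uE; apply: NB; [exact/pH/FH|exact: pL].
      have Nu : N y u.
        by apply: TF => //; rewrite -[u](subrK (u + l)); apply: FD => //; exact: NF.
      apply: ND => //; apply: LF => //.
      by rewrite -[l](addKr u) addrC; apply: FB => //; exact: NF.
    - by exists (t, 0); [split=> //; have [] := fL x|rewrite /= addr0].
  by rewrite -(Tp _ _ Tt); exact: pL.
Qed.

(** The subspace of errors of the extension is contained in N, so it is 0. *)
Lemma linear_extension (G : set (V * V)) : G 0 ->
  (forall y z, G y -> G z -> G (y + z)) -> (forall k z, G z -> G (k *: z)) ->
  (forall w, G (0, w) -> w = 0) ->
  exists h : {linear V -> V}, forall z, G z -> h z.1 = z.2.
Proof.
move=> G0 GD GZ Gf; have [|x w /Gf ->|h hG] := inj (Gamma := fun=> G).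
- exact: qcoh_const.
- exact: N0.
exists h => z Gz; apply/eqP; rewrite -subr_eq0; apply/eqP.
by apply: N_reduced => k x; rewrite scalerBr -linearZ; exact: hG (GZ k _ Gz).
Qed.

Variable p : {linear V -> V}.
Hypotheses (pp : forall v, p (p v) = p v) (pF : forall x v, F x v -> N x (p v - v)).
Hypothesis ess : forall T, qcoh_family T -> (forall x v, T x v -> p v = v) ->
  (forall x v, T x v -> F x v -> N x v) -> forall x, T x `<=` N x.

Lemma pN x v : N x v -> N x (p v).
Proof. by move=> Nv; rewrite -[p v](subrK v); apply: ND => //; apply/pF/NF. Qed.

Lemma qcoh_fixed : qcoh_family (fun _ : X => [set v | p v = v]).
Proof.
apply: qcoh_const; first by rewrite /= raddf0.
- by move=> u v pu pv; rewrite /= raddfD /= pu pv.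
- by move=> k v pv; rewrite /= linearZ /= pv.
Qed.

(** The inverse image of N under h, in p V, meets F inside N; as F is essential, it
    is contained in N. *)
Lemma kernel_reflected (h : {linear V -> V}) :
  (forall x v, F x v -> p v = v -> N x (h v - v)) ->
  forall x v, p v = v -> N x (h v) -> N x v.
Proof.
move=> hF x v pv hv.
apply: (ess (qcoh_inter (qcoh_preimage h qN) qcoh_fixed)) => [y u []//|y u [hu pu] Fu|].
  by rewrite -[u](subKr (h u)); apply: NB => //; exact: hF.
by split.
Qed.

(** A retraction r of h exists because p V / N is injective.  It is the identity on F
    modulo N as well, hence injective by [kernel_reflected], so it is the inverse. *)
Lemma identity_on_family_invertible (h : {linear V -> V}) :
  (forall v, p (h v) = h v) ->
  (forall x v, F x v -> p v = v -> N x (h v - v)) ->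
  exists r : {linear V -> V},
    [/\ forall v, p (r v) = r v, forall v, p v = v -> r (h v) = v,
        forall v, p v = v -> h (r v) = v &
        forall x v, F x v -> p v = v -> N x (r v - v)].
Proof.
move=> ph hF.
pose Gamma x := (fun z : V * V => (h z.1 + z.2, z.1)) @`
  ([set v | p v = v] `*` (N x `&` [set v | p v = v])).
have [||r' rG] := inj (Gamma := Gamma).
- apply: qcoh_image (qcoh_prod qcoh_fixed (qcoh_inter qN qcoh_fixed)) => a u v.
  rewrite -[RHS]/(a *: (h u.1 + u.2) + (h v.1 + v.2), a *: u.1 + v.1).
  by rewrite scalerDr addrACA -linearP.
- move=> x w [[u n] [/= pu [Nn pn]] [/eqP]]; rewrite addr_eq0 => /eqP hu <-.
  by apply: (kernel_reflected hF pu); rewrite hu; exact: NN.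
pose r : {linear V -> V} := p \o r'.
have rE x v n : p v = v -> N x n -> p n = n -> N x (r (h v + n) - v).
  move=> pv Nn pn; have Gvn : Gamma x (h v + n, v) by exists (v, n).
  by have := pN (rG _ _ Gvn); rewrite raddfB /= pv.
have pr v : p (r v) = r v by rewrite -[r v]/(p (r' v)) pp.
have rh v : p v = v -> r (h v) = v.
  move=> pv; apply/eqP; rewrite -subr_eq0; apply/eqP/N_reduced => k x.
  rewrite scalerBr -!linearZ -[h _]addr0; apply: rE; last exact: raddf0.
    by rewrite linearZ /= pv.
  exact: N0.
have rF x v : F x v -> p v = v -> N x (r v - v).
  move=> Fv pv; rewrite -[v in r v](subrKC (h v)); apply: rE => //.
    by rewrite -opprB; apply/NN/hF.
  by rewrite raddfB /= ph pv.
exists r; split=> // v pv.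
apply/eqP; rewrite -subr_eq0; apply/eqP/N_reduced => k x.
apply: (kernel_reflected rF); first by rewrite linearZ /= raddfB /= ph pv.
have e : r (h (r v) - v) = 0 by apply/eqP; rewrite raddfB subr_eq0; apply/eqP/rh/pr.
have -> : r (k *: (h (r v) - v)) = k *: r (h (r v) - v) by exact: linearZ.
by rewrite e scaler0.
Qed.

End Essential.

(** * Sheaves from families of stalks *)

Section RestrictScalars.
Variables (A B : comPzRingType) (f : {rmorphism A -> B}) (M : lmodType B).

Definition restrict_scalars of {rmorphism A -> B} : Type := M.
Local Notation Mf := (restrict_scalars f).
HB.instance Definition _ := GRing.Zmodule.on Mf.

Definition restrict_scale (a : A) (m : Mf) : Mf := f a *: (m : M).

Fact restrict_scaleA a b m :
  restrict_scale a (restrict_scale b m) = restrict_scale (a * b) m.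
Proof. by rewrite /restrict_scale scalerA -rmorphM. Qed.
Fact restrict_scale1 : left_id 1 restrict_scale.
Proof. by move=> m; rewrite /restrict_scale rmorph1 scale1r. Qed.
Fact restrict_scaleDr : right_distributive restrict_scale +%R.
Proof. by move=> a m n; exact: scalerDr. Qed.
Fact restrict_scaleDl m : {morph restrict_scale^~ m : a b / a + b}.
Proof. by move=> a b; rewrite /restrict_scale rmorphD scalerDl. Qed.

HB.instance Definition _ := GRing.Zmodule_isLmodule.Build A Mf
  restrict_scaleA restrict_scale1 restrict_scaleDr restrict_scaleDl.

Definition restrict_id (m : Mf) : M := m.

Fact restrict_id_linear : linear_for (f \; *:%R) restrict_id.
Proof. by []. Qed.

HB.instance Definition _ := GRing.isLinear.Build A Mf M (f \; *:%R) restrict_id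
  restrict_id_linear.

End RestrictScalars.

Section FamilySheaf.
Variables (X : scheme) (intX : integral_scheme X).
Local Notation eta := (generic intX).
Local Notation K := (function_field intX).
Local Notation kap := (gval intX).
Local Notation to_eta := (generic_in intX).
Variable V : lmodType K.

Record family := Family {
  fam_stalk :> X -> set V;
  famP : qcoh_family fam_stalk }.

Section Sections.
Variable S : family.

Let fS : stalk_family S. Proof. by case: (famP S). Qed.

(** Without the second condition, which only concerns the empty set, the sheaf
    axiom would fail there. *)
Definition is_section (U : opens X) (v : V) : Prop :=
  (forall x, opens_set U x -> S x v) /\ (~ opens_set U eta -> v = 0).

Record fsect (U : opens X) := FSect {
  fval : V;
  fvalP : is_section U fval }.

HB.instance Definition _ (U : opens X) := gen_eqMixin (fsect U).
HB.instance Definition _ (U : opens X) := gen_choiceMixin (fsect U).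

Lemma fsect_eq (U : opens X) (s t : fsect U) : fval s = fval t -> s = t.
Proof.
case: s t => [s sP] [t tP] /= st; subst t.
by rewrite (Prop_irrelevance sP tP).
Qed.

Lemma fval_stalk (U : opens X) (s : fsect U) x : opens_set U x -> S x (fval s).
Proof. by case: (fvalP s) => + _; apply. Qed.

Lemma fval_empty (U : opens X) (s : fsect U) : ~ opens_set U eta -> fval s = 0.
Proof. by case: (fvalP s). Qed.

Section OverU.
Variable U : opens X.

Fact is_section0 : is_section U 0.
Proof. by split=> // x _; have [] := fS x. Qed.

Fact is_sectionD (s t : fsect U) : is_section U (fval s + fval t).
Proof.
split=> [x Ux|nU]; last by rewrite !fval_empty // addr0.
by have [_ SD _] := fS x; apply: SD; exact: fval_stalk.
Qed.

Fact is_sectionN (s : fsect U) : is_section U (- fval s).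
Proof.
split=> [x Ux|nU]; last by rewrite fval_empty // oppr0.
by apply: stalk_family_opp => //; exact: fval_stalk.
Qed.

Fact is_sectionZ (a : sect U) (s : fsect U) : is_section U (kap a *: fval s).
Proof.
split=> [x Ux|nU]; last by rewrite fval_empty // scaler0.
by have [_ _ SZ] := fS x; apply: SZ => //; exact: fval_stalk.
Qed.

Definition fsect0 := FSect is_section0.
Definition fsectD s t := FSect (is_sectionD s t).
Definition fsectN s := FSect (is_sectionN s).
Definition fsectZ a s := FSect (is_sectionZ a s).

Fact fsectDA : associative fsectD.
Proof. by move=> s t u; apply: fsect_eq; exact: addrA. Qed.
Fact fsectDC : commutative fsectD.
Proof. by move=> s t; apply: fsect_eq; exact: addrC. Qed.
Fact fsectD0 : left_id fsect0 fsectD.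
Proof. by move=> s; apply: fsect_eq; exact: add0r. Qed.
Fact fsectDN : left_inverse fsect0 fsectN fsectD.
Proof. by move=> s; apply: fsect_eq; exact: addNr. Qed.

HB.instance Definition _ :=
  GRing.isZmodule.Build (fsect U) fsectDA fsectDC fsectD0 fsectDN.

Fact fsectZA a b s : fsectZ a (fsectZ b s) = fsectZ (a * b) s.
Proof. by apply: fsect_eq; rewrite /= scalerA gvalM. Qed.
Fact fsect1Z : left_id 1 fsectZ.
Proof.
move=> s; apply: fsect_eq => /=; have [Ueta|nU] := pselect (opens_set U eta).
  by rewrite (gval1 intX Ueta) scale1r.
by rewrite fval_empty // scaler0.
Qed.
Fact fsectZDr : right_distributive fsectZ +%R.
Proof. by move=> a s t; apply: fsect_eq; exact: scalerDr. Qed.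
Fact fsectZDl s : {morph fsectZ^~ s : a b / a + b}.
Proof. by move=> a b; apply: fsect_eq; rewrite /= raddfD scalerDl. Qed.

HB.instance Definition _ := GRing.Zmodule_isLmodule.Build (sect U) (fsect U)
  fsectZA fsect1Z fsectZDr fsectZDl.

Lemma fvalZ (a : sect U) (s : fsect U) : fval (a *: s) = kap a *: fval s.
Proof. by []. Qed.

Lemma fvalD (s t : fsect U) : fval (s + t) = fval s + fval t.
Proof. by []. Qed.

Lemma fval0 : fval (0 : fsect U) = 0.
Proof. by []. Qed.

End OverU.

Section Restriction.
Variables (U W : opens X) (WU : W `<=` U).

Definition fres_val (v : V) : V := if pselect (opens_set W eta) then v else 0.

Fact is_section_res (s : fsect U) : is_section W (fres_val (fval s)).
Proof.
rewrite /fres_val; case: pselect => [Weta|nW]; last first.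
  by split=> // x Wx; have [] := fS x.
by split=> // x Wx; apply: fval_stalk; exact: WU.
Qed.

Definition fres (s : fsect U) : fsect W := FSect (is_section_res s).

Fact fres_linear : linear_for (res WU \; *:%R) fres.
Proof.
move=> a s t; apply: fsect_eq.
rewrite -[RHS]/(kap (res WU a) *: fres_val (fval s) + fres_val (fval t)).
rewrite -[LHS]/(fres_val (kap a *: fval s + fval t)) /fres_val.
case: pselect => [Weta|nW]; last by rewrite scaler0 addr0.
by rewrite (gval_res intX WU a Weta).
Qed.

HB.instance Definition _ := GRing.isLinear.Build (sect U) (fsect U) (fsect W)
  (res WU \; *:%R) fres fres_linear.

Lemma fval_res (s : fsect U) x : opens_set W x -> fval (fres s) = fval s.
Proof. by move=> /to_eta Weta; rewrite /= /fres_val; case: pselect. Qed.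

End Restriction.

Fact fres_id (U : opens X) (UU : U `<=` U) s : fres UU s = s.
Proof.
apply: fsect_eq; rewrite /= /fres_val; case: pselect => // nU.
by rewrite fval_empty.
Qed.

Fact fres_comp (U W Y : opens X) (WU : W `<=` U) (YW : Y `<=` W) (YU : Y `<=` U) s :
  fres YW (fres WU s) = fres YU s.
Proof.
apply: fsect_eq; rewrite /= /fres_val; case: pselect => // Yeta.
by case: pselect => // nW; case: nW; exact: YW.
Qed.

Fact fres_sheaf : @sheaf_axiom X fsect (fun U W WU => fres WU).
Proof.
move=> U C CU; split=> [s t st|s sC].
  apply: fsect_eq; have [Ueta|nU] := pselect (opens_set U eta); last first.
    by rewrite !fval_empty.
  have : (\bigcup_(W in C) W) eta by rewrite CU.
  move=> [W CW Weta]; have WU : W `<=` U by rewrite -CU; exact: bigcup_sup.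
  by rewrite -(fval_res WU s Weta) -(fval_res WU t Weta) st.
have [Ueta|nU] := pselect (opens_set U eta); last first.
  have nC W : C W -> ~ opens_set W eta.
    by move=> CW Weta; apply: nU; rewrite -CU; exists W.
  exists 0 => W WU CW; apply: fsect_eq.
  by rewrite !fval_empty //; exact: nC.
have : (\bigcup_(W in C) W) eta by rewrite CU.
move=> [W0 CW0 W0eta].
have sE W : C W -> opens_set W eta -> fval (s W) = fval (s W0).
  move=> CW Weta; have /(congr1 (@fval _)) := sC W W0 CW CW0.
  have Ieta : opens_set (opensI W W0) eta by [].
  by rewrite (fval_res _ _ Ieta) (fval_res _ _ Ieta).
have tP : is_section U (fval (s W0)).
  split=> // x Ux; have : (\bigcup_(W in C) W) x by rewrite CU.
  by move=> [W CW Wx]; rewrite -(sE W CW (to_eta Wx)); exact: fval_stalk.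
exists (FSect tP) => W WU CW; apply: fsect_eq.
have [Weta|nW] := pselect (opens_set W eta); last by rewrite !fval_empty.
by rewrite (fval_res WU _ Weta) sE.
Qed.

Definition family_moduleSheaf : moduleSheaf X :=
  @ModuleSheaf X (fun U => fsect U : lmodType (sect U)) (fun U W WU => fres WU)
    fres_id fres_comp fres_sheaf.

Lemma family_quasi_coherent : @quasi_coherent X family_moduleSheaf.
Proof.
move=> x; have [U [Ux [c]]] := scheme_affine x; exists U, c; split=> //.
exists (restrict_scalars (fsect U) (chart_sect c)).
exists (@restrict_id _ _ (chart_sect c) (fsect U)) => f W WU fW.
have WE : W = chart_basic f by apply: opens_eq; rewrite -fW.
subst W.
have [[b fb] _ _] := chart_loc WU fW; rewrite /= in fb.
split.
- exists (fun y => b *: y) => y /=; first by rewrite scalerA mulrC fb scale1r.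
  by rewrite scalerA fb scale1r.
- move=> y; have [fS' qS] := famP S.
  have [p pf|n In] := power_in_ideal
      (colon_ideal fS (c := c) setT (fval y)) (f := f).
    have Sp : S (chart_map c p) (fval y) by apply: fval_stalk; apply/chart_basicE.
    by have [a [pa av]] := qS U c p _ Sp; exists a; split.
  have mP : is_section U (kap (chart_sect c (f ^+ n)) *: fval y).
    split=> [z /(chart_onto c)[q ->]|nU]; first exact: In.
    by case: nU; exact: to_eta Ux.
  exists n, (FSect mP); apply: fsect_eq => /=; rewrite /fres_val.
  case: pselect => [Weta|nW]; last by rewrite (fval_empty y nW) scaler0.
  by rewrite -!rmorphXn (gval_res intX WU _ Weta) rmorphXn.
- move=> s t /(congr1 (@fval _)) /=; rewrite /fres_val.
  case: pselect => [Weta st|nW _].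
    by exists 0%N; rewrite !expr0 !scale1r; exact: fsect_eq.
  have [||n f0] := @power_in_ideal _ [set 0] f.
  + by split=> //= [a b' -> ->|a b' ->]; rewrite ?addr0 ?mulr0.
  + move=> p pf; case: nW; apply: to_eta; apply/chart_basicE; exact: pf.
  + exists n; rewrite f0 /=.
    by rewrite !scale0r.
Qed.

Definition family_sheaf : qcohSheaf X := QcohSheaf family_quasi_coherent.

Lemma family_torsion_free : locally_torsion_free family_sheaf.
Proof.
move=> U U0 [c] a s as0; have [a0|a0] := pselect (a = 0); [by left|right].
have U1 : U `<=` chart_basic (1 : chart_ring c).
  by move=> _ /(chart_onto c)[p ->]; apply/chart_basicE; exact: prime1.
have [_ frac _] := chart_basic_loc (c := c) 1.
have [n [a' /=]] := frac (res (@chart_basic_sub _ _ c 1) a).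
rewrite !rmorph1 expr1n mul1r => aE.
have {}aE : a = chart_sect c a'.
  have back b := res_comp (@chart_basic_sub _ _ c 1) U1 (@subset_refl _ U) b.
  by rewrite -(res_id (@subset_refl _ U) a) -back aE back res_id.
have a'0 : a' <> 0 by move=> a'0; apply: a0; rewrite aE a'0 rmorph0.
have [||p [_ pa]] := @exists_prime _ [set 0] a'.
- by split=> //= [b b' -> ->|b b' ->]; rewrite ?addr0 ?mulr0.
- by move=> k; exact: chart_domainX.
have [Y [b [_ ba]]] := gval_chart_unit intX pa.
apply: fsect_eq; rewrite fval0 -[fval s]scale1r -ba -aE -scalerA.
by rewrite -fvalZ as0 fval0 scaler0.
Qed.

End Sections.
End FamilySheaf.

(** * The cover *)

Lemma module_hom0 (X : ringedSpace) (F G : moduleSheaf X) (f : module_hom F G)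
  (U : opens X) : f U 0 = 0.
Proof.
have := mhom_linear f (U := U) 1 0 0; rewrite scaler0 addr0 scale1r => /eqP.
by rewrite -subr_eq subrr => /eqP.
Qed.

Section Cover.
Variables (X : scheme) (intX : integral_scheme X) (M : qcohSheaf X).
Local Notation eta := (generic intX).
Local Notation K := (function_field intX).
Local Notation kap := (gval intX).
Local Notation to_eta := (generic_in intX).
Local Notation V := (universal_space intX M).
Local Notation F := (@cover_family X intX M).
Local Notation N := (@kernel_family X intX M).

Let qF : qcoh_family F. Proof. exact: qcoh_cover_family. Qed.
Let qN : qcoh_family N. Proof. exact: qcoh_kernel_family. Qed.
Let NF : forall x, N x `<=` F x. Proof. exact: kernel_sub_cover. Qed.
Let N_reduced : forall v, (forall k x, N x (k *: v)) -> v = 0.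
Proof. exact: kernel_reduced. Qed.
Let inj := relative_injectivity (intX := intX) (M := M).

Variable p : {linear V -> V}.
Hypotheses (pp : forall v, p (p v) = p v) (pF : forall x v, F x v -> N x (p v - v)).
Hypothesis ess : forall T, qcoh_family T -> (forall x v, T x v -> p v = v) ->
  (forall x v, T x v -> F x v -> N x v) -> forall x, T x `<=` N x.

(** The largest quasi-coherent lift of M, cut down to the injective hull p V. *)
Definition cover_stalks : family V :=
  Family (qcoh_inter qF (qcoh_fixed p)).

Definition cover_sheaf : qcohSheaf X := family_sheaf cover_stalks.

Fact cover_map_exists (U : opens X) (s : cover_sheaf U) :
  {m : M U | lifts (fval s) m}.
Proof.
by apply/cid/cover_lifts => x Ux; have [] := fval_stalk s Ux.
Qed.

Definition cover_map_fun (U : opens X) (s : cover_sheaf U) : M U :=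
  sval (cover_map_exists s).

Lemma cover_map_lifts (U : opens X) (s : cover_sheaf U) :
  lifts (fval s) (cover_map_fun s).
Proof. exact: (svalP (cover_map_exists s)). Qed.

Fact cover_map_linear (U : opens X) : linear (@cover_map_fun U).
Proof.
move=> a s t; apply: lifts_uniq (cover_map_lifts _) _.
exact: (lifts_linear a (cover_map_lifts s) (cover_map_lifts t)).
Qed.

Fact cover_map_natural (U W : opens X) (WU : W `<=` U) (s : cover_sheaf U) :
  mres M WU (cover_map_fun s) = cover_map_fun (mres cover_sheaf WU s).
Proof.
have [Weta|nW] := pselect (opens_set W eta).
  apply: lifts_uniq (lifts_res WU (cover_map_lifts s)) _.
  by rewrite -(fval_res WU s Weta); exact: cover_map_lifts.
apply: (sheaf_empty (@mres_sheaf X M)) => x Wx; apply: nW; exact: to_eta Wx.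
Qed.

Definition cover_map : module_hom cover_sheaf M :=
  ModuleHom cover_map_linear cover_map_natural.

Lemma lifts_kernel (U : opens X) v w (m : M U) :
  (forall x, opens_set U x -> N x (w - v)) -> lifts v m -> lifts w m.
Proof.
move=> vw vm chi Y YU Yx r.
have k1 := gval1 intX (YU _ Yx).
have := lifts_linear 1 (kernel_lifts0 vw) vm; rewrite k1 scale1r subrK scale1r add0r.
exact.
Qed.

(** The projection p changes a lift to V only by the kernel. *)
Lemma cover_map_precover (F' : qcohSheaf X) (psi : module_hom F' M) :
  locally_torsion_free F' ->
  exists g : module_hom F' cover_sheaf, module_comp cover_map g = psi.
Proof.
move=> tfF'; have [h hP] := torsion_free_lift intX psi tfF'.
pose gv (U : opens X) (s : F' U) : V :=
  if pselect (opens_set U eta) is left Ueta then p (h (mgerm Ueta s)) else 0.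
have gvE (U : opens X) (Ueta : opens_set U eta) (s : F' U) :
    gv U s = p (h (mgerm Ueta s)).
  by rewrite /gv; case: pselect => // Ueta'; rewrite (Prop_irrelevance Ueta Ueta').
have gP (U : opens X) (s : F' U) : is_section cover_stalks U (gv U s).
  split=> [x Ux|nU]; last by rewrite /gv; case: pselect.
  have [_ Fh] := hP x U Ux s; rewrite (gvE _ (to_eta Ux)); split; last exact: pp.
  rewrite -[p _](subrK (h (mgerm (to_eta Ux) s))).
  have [fF _] := qF; have [_ FD _] := fF x.
  by apply: FD => //; apply/NF/pF.
pose g (U : opens X) (s : F' U) : cover_sheaf U := FSect (gP U s).
have glin U : linear (g U).
  move=> a s t; apply: fsect_eq.
  rewrite -[LHS]/(gv U (a *: s + t)) -[RHS]/(kap a *: gv U s + gv U t).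
  have [Ueta|nU] := pselect (opens_set U eta); last first.
    by rewrite /gv; case: pselect => // _; rewrite scaler0 addr0.
  rewrite !(gvE _ Ueta) -!linearP; congr (p (h _)).
  by rewrite raddfD /= mgermZ -gvalE.
have gnat (U W : opens X) (WU : W `<=` U) (s : F' U) :
    mres cover_sheaf WU (g U s) = g W (mres F' WU s).
  apply: fsect_eq; have [Weta|nW] := pselect (opens_set W eta); last first.
    by rewrite !fval_empty.
  rewrite [LHS](fval_res WU _ Weta) /= (gvE _ Weta) (gvE _ (WU _ Weta)).
  by rewrite (mgerm_res (WU _ Weta)).
exists (ModuleHom glin gnat); apply: module_hom_eq => U s /=.
have [Ueta|nU] := pselect (opens_set U eta); last first.
  by apply: (sheaf_empty (@mres_sheaf X M)) => x Ux; apply: nU; exact: to_eta Ux.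
have [hU _] := hP _ U Ueta s.
apply: lifts_uniq (cover_map_lifts _) (lifts_kernel _ hU) => x Ux.
have [_ Fh] := hP _ U Ux s.
rewrite /= (gvE _ (to_eta Ux)) (Prop_irrelevance (generic_in intX Ueta) (to_eta Ux)).
exact: pF.
Qed.

(** On germs at the generic point f is linear over the function field, so
    [linear_extension] applies to its graph there. *)
Lemma cover_endo_extends (f : module_hom cover_sheaf cover_sheaf) :
  exists h : {linear V -> V}, (forall v, p (h v) = h v) /\
    forall (U : opens X) (s : cover_sheaf U), opens_set U eta -> h (fval s) = fval (f U s).
Proof.
pose G := [set z : V * V | exists (U : opens X) (s : cover_sheaf U),
  opens_set U eta /\ z = (fval s, fval (f U s))].
have fR (U W : opens X) (WU : W `<=` U) (s : cover_sheaf U) : opens_set W eta ->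
    fval (f W (mres cover_sheaf WU s)) = fval (f U s).
  by move=> Weta; rewrite -mhom_natural; exact: (fval_res WU _ Weta).
have G0 : G 0 by exists (Opens openT), 0; rewrite module_hom0.
have GD y z : G y -> G z -> G (y + z).
  move=> [U [s [Ueta ->]]] [W [t [Weta ->]]].
  have Yeta : opens_set (opensI U W) eta by [].
  pose s' := mres cover_sheaf (@opensIl _ U W) s.
  pose t' := mres cover_sheaf (@opensIr _ U W) t.
  have fD : f (opensI U W) (s' + t') = f _ s' + f _ t'.
    by have := mhom_linear f 1 s' t'; rewrite !scale1r.
  exists (opensI U W), (s' + t'); split=> //.
  rewrite fD !fvalD (fR _ _ _ _ Yeta) (fR _ _ _ _ Yeta).
  by rewrite (fval_res _ s Yeta) (fval_res _ t Yeta).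
have GZ k z : G z -> G (k *: z).
  move=> [U [s [Ueta ->]]]; have [W [Weta [a ->]]] := rgermP k.
  have Yeta : opens_set (opensI U W) eta by [].
  pose s' := mres cover_sheaf (@opensIl _ U W) s.
  pose a' := res (@opensIr _ U W) a.
  have fZ : f (opensI U W) (a' *: s') = a' *: f _ s'.
    by have := mhom_linear f a' s' 0; rewrite module_hom0 !addr0.
  exists (opensI U W), (a' *: s'); split=> //.
  rewrite fZ !fvalZ (fR _ _ _ _ Yeta) (fval_res _ s Yeta).
  by rewrite (gval_res intX _ _ Yeta) (gvalE Weta).
have Gf w : G (0, w) -> w = 0.
  move=> [U [s [_ [s0 ->]]]].
  have -> : s = 0 by apply: fsect_eq; rewrite -s0.
  by rewrite module_hom0.
have [h hG] := linear_extension qN N_reduced inj G0 GD GZ Gf.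
pose ph : {linear V -> V} := p \o h.
exists ph; split=> [v|U s Ueta]; first exact: pp.
have hs : h (fval s) = fval (f U s) by apply: (hG (_, _)); exists U, s.
rewrite -[LHS]/(p (h (fval s))) hs.
by have [] := fval_stalk (f U s) Ueta.
Qed.

(** The extension h of f is the identity modulo the kernel on the stalks of the
    cover; its inverse is too, so it maps these stalks to themselves. *)
Lemma cover_endo_iso (f : module_hom cover_sheaf cover_sheaf) :
  module_comp cover_map f = cover_map ->
  exists g : module_hom cover_sheaf cover_sheaf,
    module_comp g f = module_id cover_sheaf /\ module_comp f g = module_id cover_sheaf.
Proof.
move=> fM; have [h [ph hE]] := cover_endo_extends f.
have fN (U : opens X) (s : cover_sheaf U) x : opens_set U x ->
    N x (fval (f U s) - fval s).
  move=> Ux; have [fF _] := qF.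
  apply: kernel_familyE; first exact: (qcohP M).
    have [Ffs _] := fval_stalk (f U s) Ux; have [Fs _] := fval_stalk s Ux.
    exact: stalk_family_sub.
  have ms := cover_map_lifts s; have mfs := cover_map_lifts (f U s).
  have fms : cover_map_fun (f U s) = cover_map_fun s.
    by have := congr1 (fun k : module_hom cover_sheaf M => k U s) fM.
  rewrite fms in mfs => chi Y Yx r chix.
  have Ux' : opens_set U (ch_point chi) by rewrite chix.
  have Zx : opens_set (opensI U Y) (ch_point chi) by [].
  rewrite -(gval_res intX (@opensIr _ U Y) r Zx).
  rewrite -[LHS]/(fval (f U s) chi (kap _) - fval s chi (kap _)).
  by rewrite (mfs _ _ (@opensIl _ U Y) Zx) (ms _ _ (@opensIl _ U Y) Zx) subrr.
have hF x v : F x v -> p v = v -> N x (h v - v).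
  move=> Fv pv; have Sv : cover_stalks x v by [].
  have [Y [Yx YS]] := qcoh_nbhd (famP cover_stalks) Sv.
  have vP : is_section cover_stalks Y v by split=> // nY; case: nY; exact: to_eta Yx.
  have := fN Y (FSect vP) x Yx.
  by rewrite -(hE Y (FSect vP) (to_eta Yx)).
have [r [pr rh hr rF]] :=
  identity_on_family_invertible qN NF N_reduced inj pp pF ess ph hF.
have rP (U : opens X) (s : cover_sheaf U) : is_section cover_stalks U (r (fval s)).
  split=> [x Ux|nU]; last by rewrite (fval_empty s nU) linear0.
  have [Fs ps] := fval_stalk s Ux; split; last exact: pr.
  have [fF _] := qF; have [_ FD _] := fF x.
  by rewrite -[r _](subrK (fval s)); apply: FD => //; apply/NF/rF.
pose g (U : opens X) (s : cover_sheaf U) : cover_sheaf U := FSect (rP U s).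
have glin U : linear (g U).
  by move=> a s t; apply: fsect_eq; exact: linearP.
have gnat (U W : opens X) (WU : W `<=` U) (s : cover_sheaf U) :
    mres cover_sheaf WU (g U s) = g W (mres cover_sheaf WU s).
  apply: fsect_eq; have [Weta|nW] := pselect (opens_set W eta); last first.
    by rewrite !fval_empty.
  rewrite [LHS](fval_res WU _ Weta) /=; congr (r _); symmetry.
  exact: (fval_res WU s Weta).
exists (ModuleHom glin gnat); split; apply: module_hom_eq => U s /=; apply: fsect_eq;
  have [Ueta|nU] := pselect (opens_set U eta); do ?[by rewrite !fval_empty].
- apply: etrans (congr1 r (esym (hE U s Ueta))) _; apply: rh.
  by have [] := fval_stalk s Ueta.
- apply: etrans (esym (hE U (g U s) Ueta)) _; apply: hr.
  by have [] := fval_stalk s Ueta.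
Qed.

End Cover.

Theorem mainTheorem2 (X : scheme) (X_integral : integral_scheme X) :
  forall M : Qcoh X, has_cover (@locally_torsion_free X : Qcoh X -> Prop) M.
Proof.
move=> M; have [p [pp pF ess]] := essential_projection
  (@qcoh_kernel_family X X_integral M) (@qcoh_cover_family X X_integral M)
  (@kernel_sub_cover X X_integral M) (@kernel_reduced X X_integral M)
  (relative_injectivity (intX := X_integral) (M := M)).
exists (cover_sheaf p), (cover_map p); split; first split.
- exact: family_torsion_free.
- by move=> F' psi; exact: cover_map_precover.
- by move=> f; exact: cover_endo_iso.
Qed.
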